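(* Let $\mathfrak{A}$ be a $C^*$-algebra and let $H$ and $K$ be non-zero Hilbert $\mathfrak{A}$-modules. Let $f$ and $g$ be non-negative continuous functions on the interval $[0,+\infty)$ such that $f(t)g(t)=t$ for all $t\in[0,+\infty)$. Then for every $T\in\mathcal{L}(H,K)\setminus\{0\}$ and every $\alpha\in(0,1]$, $$\|\langle Tx,y\rangle\|\le \|T\|^{1-\alpha}\cdot \|f(|T|^\alpha)x\|\cdot\|g(|T^*|^\alpha)y\|\quad\text{for all } x\in H,\ y\in K.$$
   Context: Hilbert $\mathfrak{A}$-modules are right Hilbert $C^*$-modules over $\mathfrak{A}$, with $\mathfrak{A}$-valued inner product $\langle\cdot,\cdot\rangle$ and norm $\|x\|=\|\langle x,x\rangle\|^{1/2}$; $\|\langle x,y\rangle\|$ is the norm in $\mathfrak{A}$. $\mathcal{L}(H,K)$ is the set of all adjointable operators from $H$ to $K$, $T^*$ is the adjoint of $T$, $\|T\|$ is the operator norm. $|T|=(T^*T)^{1/2}\in\mathcal{L}(H)$ and $|T^*|=(TT^* )^{1/2}\in\mathcal{L}(K)$; powers and $f(\cdot)$, $g(\cdot)$ of positive operators are defined by the continuous functional calculus in the $C^*$-algebras $\mathcal{L}(H)=\mathcal{L}(H,H)$ and $\mathcal{L}(K)=\mathcal{L}(K,K)$. *)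

(* Defs.v *)
From HB Require Import structures.
From mathcomp Require Import all_boot all_order all_algebra.
From mathcomp Require Import complex.
From mathcomp Require Import boolp classical_sets functions set_interval reals.
From mathcomp Require Import topology normedtype exp.

Set Implicit Arguments.
Unset Strict Implicit.
Unset Printing Implicit Defensive.

Import Order.TTheory GRing.Theory Num.Theory.
Import numFieldNormedType.Exports.

Local Open Scope classical_set_scope.
Local Open Scope ring_scope.
Local Open Scope complex_scope.

(* R[i] seen as a numFieldType: on this form the topology of a numFieldType is
   found by unification. *)
Definition cplx (R : realType) : numFieldType := R[i].

(* The norm of a normed module over R[i] lies in R[i]; its imaginary part is
   zero. *)
Definition rnorm (R : realType) (V : normedModType R[i]) (x : V) : R :=
  complex.Re `|x|.

(* C*-algebras are not assumed to be unital, hence the product is not the one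
   of a MathComp ring structure. *)
HB.mixin Record isCStarAlgebra (R : realType) (A : Type)
    & CompleteNormedModule R[i] A := {
  cmul : A -> A -> A;
  cstar : A -> A;
  cmulA : forall a b c, cmul a (cmul b c) = cmul (cmul a b) c;
  cmulDl : forall a b c, cmul (a + b) c = cmul a c + cmul b c;
  cmulDr : forall a b c, cmul a (b + c) = cmul a b + cmul a c;
  cmulZl : forall (k : R[i]) a b, cmul (k *: a) b = k *: cmul a b;
  cmulZr : forall (k : R[i]) a b, cmul a (k *: b) = k *: cmul a b;
  cnormM : forall a b, `|cmul a b| <= `|a| * `|b|;
  cstarK : forall a, cstar (cstar a) = a;
  cstarD : forall a b, cstar (a + b) = cstar a + cstar b;
  cstarZ : forall (k : R[i]) a, cstar (k *: a) = conjc k *: cstar a;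
  cstarM : forall a b, cstar (cmul a b) = cmul (cstar b) (cstar a);
  cnorm_star : forall a, `|cmul (cstar a) a| = `|a| ^+ 2 }.

#[short(type="cStarAlgType")]
HB.structure Definition CStarAlgebra (R : realType) :=
  { A of isCStarAlgebra R A & CompleteNormedModule R[i] A }.

Definition cpositive (R : realType) (A : cStarAlgType R) (a : A) : Prop :=
  exists b : A, a = cmul (cstar b) b.

(* Right Hilbert A-modules: the inner product is conjugate-linear in its first
   argument and A-linear in its second one; [hnorm_inner] says that the norm for
   which the module is complete is the one given by the inner product. *)
HB.mixin Record isHilbertModule (R : realType) (A : cStarAlgType R) (H : Type)
    & CompleteNormedModule R[i] H := {
  hact : H -> A -> H;
  inner : H -> H -> A;
  hactDl : forall x y a, hact (x + y) a = hact x a + hact y a;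
  hactDr : forall x a b, hact x (a + b) = hact x a + hact x b;
  hactM : forall x a b, hact x (cmul a b) = hact (hact x a) b;
  hactZl : forall (k : R[i]) x a, hact (k *: x) a = k *: hact x a;
  hactZr : forall (k : R[i]) x a, hact x (k *: a) = k *: hact x a;
  innerDr : forall x y z, inner x (y + z) = inner x y + inner x z;
  innerZr : forall (k : R[i]) x y, inner x (k *: y) = k *: inner x y;
  inner_act : forall x y a, inner x (hact y a) = cmul (inner x y) a;
  innerC : forall x y, inner y x = cstar (inner x y);
  inner_ge0 : forall x, cpositive (inner x x);
  inner_eq0 : forall x, inner x x = 0 -> x = 0;
  hnorm_inner : forall x, `|inner x x| = `|x| ^+ 2 }.

#[short(type="hilbertModType")]
HB.structure Definition HilbertModule (R : realType) (A : cStarAlgType R) :=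
  { H of isHilbertModule R A H & CompleteNormedModule R[i] H }.

(* The adjoint is part of the data, but it is determined by the operator;
   linearity and boundedness of both maps follow from [adjointP]. *)
Record adjointable (R : realType) (A : cStarAlgType R)
    (H K : hilbertModType A) := Adjointable {
  adj_fun :> H -> K;
  adj_cofun : K -> H;
  adjointP : forall x y, inner (adj_fun x) y = inner x (adj_cofun y) }.

Section Operators.
Variables (R : realType) (A : cStarAlgType R).
Implicit Types H K L : hilbertModType A.

Lemma adjoint_subproof H K (T : adjointable H K) (y : K) (x : H) :
  inner (adj_cofun T y) x = inner y (T x).
Proof. by rewrite innerC -adjointP -innerC. Qed.

Definition adjoint H K (T : adjointable H K) : adjointable K H :=
  Adjointable (adjoint_subproof T).

Lemma adj_comp_subproof H K L (S : adjointable K L) (T : adjointable H K)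
    (x : H) (z : L) :
  inner (S (T x)) z = inner x (adjoint T (adjoint S z)).
Proof. by rewrite !adjointP. Qed.

Definition adj_comp H K L (S : adjointable K L) (T : adjointable H K) :
  adjointable H L := Adjointable (adj_comp_subproof S T).

Definition opnorm H K (T : adjointable H K) : R :=
  sup [set rnorm (T x) | x in [set x : H | rnorm x <= 1]].

Definition spectrum H (a : adjointable H H) : set (cplx R) :=
  [set l | ~ exists S : adjointable H H, forall x : H,
     S (a x - (l : R[i]) *: x) = x /\ a (S x) - (l : R[i]) *: S x = x].

(* [is_cfc_hom a Phi]: Phi is a unital *-homomorphism from C(spectrum a) to L(H)
   that maps the inclusion of the spectrum to a. An element of C(spectrum a) is
   represented by any function R[i] -> R[i] whose restriction to the spectrum is
   continuous, two functions being identified when they agree there. *)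
Record is_cfc_hom H (a : adjointable H H)
    (Phi : (cplx R -> cplx R) -> adjointable H H) : Prop := {
  cfc_eq_on : forall h k : cplx R -> cplx R, {in spectrum a, h =1 k} -> Phi h =1 Phi k;
  cfc_unit : Phi (fun=> 1) =1 id;
  cfc_id : Phi id =1 a;
  cfcD : forall h k : cplx R -> cplx R, {within spectrum a, continuous h} ->
    {within spectrum a, continuous k} ->
    forall x, Phi (fun z => h z + k z) x = Phi h x + Phi k x;
  cfcZ : forall (c : cplx R) (h : cplx R -> cplx R), {within spectrum a, continuous h} ->
    forall x, Phi (fun z => c * h z) x = (c : R[i]) *: Phi h x;
  cfcM : forall h k : cplx R -> cplx R, {within spectrum a, continuous h} ->
    {within spectrum a, continuous k} ->
    forall x, Phi (fun z => h z * k z) x = Phi h (Phi k x);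
  cfc_star : forall h : cplx R -> cplx R, {within spectrum a, continuous h} ->
    Phi (fun z => conjc (h z)) =1 adjoint (Phi h) }.

(* Continuous functional calculus phi(a) for a positive operator a and a
   function phi continuous on [0, +oo[; the spectrum of a is then contained in
   [0, +oo[. The fallback value is irrelevant: the homomorphism exists, and it is
   unique on C(spectrum a). *)
Definition cfc (phi : R -> R) H (a : adjointable H H) : adjointable H H :=
  match pselect (exists Phi, is_cfc_hom a Phi) with
  | left e => sval (cid e) (fun z => (phi (complex.Re z))%:C)
  | right _ => a
  end.

Definition absop H K (T : adjointable H K) : adjointable H H :=
  cfc Num.sqrt (adj_comp (adjoint T) T).

Definition powop H (a : adjointable H H) (r : R) : adjointable H H :=
  cfc (fun t => t `^ r) a.

End Operators.

(* Main.v *)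
Require Import Defs.
From HB Require Import structures.
From mathcomp Require Import all_boot all_order all_algebra.
From mathcomp Require Import complex ring lra.
From mathcomp Require Import boolp classical_sets functions set_interval reals.
From mathcomp Require Import topology normedtype exp.

(** Put [a = T^* T], [b = T T^*] and [s t = (sqrt t)^alpha], so that the two
    operators on the right-hand side are [F = (f o s)(a)] and [G = (g o s)(b)].
    The identity [f g = id] gives [(g o s)(f o s) = s].  If [s(a)] were
    invertible, [T] would factor as [G V F] with [V = T s(a)^-1], because
    [(g o s)(b) T = T (g o s)(a)]; moreover [||V||^2 = ||s(a)^-1 a s(a)^-1||] is
    at most the supremum of [t^(1-alpha)] over [[0, ||T||^2]], that is
    [||T||^(2(1-alpha))].  The inequality would then be the Cauchy-Schwarz
    inequality for [<V F x, G y>].  In general [s(a)^-1] is replaced by [q(a)]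
    with [q t = 1 / s (max t e)]: the bound on [V] persists, and the error
    [T - G V F = T (1 - s q)(a)] has norm at most [sqrt e], since [t (1 - s q)^2]
    vanishes for [t >= e] and is at most [e] below.  Letting [e] tend to [0]
    proves the theorem.

    This argument uses the continuous functional calculus of [a] and [b], the
    Cauchy-Schwarz inequality [||<x, y>|| <= ||x|| ||y||] in Hilbert modules and
    the boundedness of adjointable operators, which are established here.

    - Order theory of a unital C*-algebra, without spectral theory.  If [c] is
      self-adjoint of norm at most [t], a power-series-like iteration produces a
      square root of [t - c] which commutes with everything commuting with [c]
      ([sqrt_scal_sub]).  For commuting self-adjoint [d] and [e], the C*-identity
      applied to [d + i e] gives [||d^2|| <= ||d^2 + e^2||].  From these two facts
      follow the characterisation of positivity by [||t - a|| <= t], the stability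
      of positivity under sums ([positiveD]), the monotonicity of the norm
      ([positive_le_norm]) and the positivity of [x^* x] ([positive_ustar_mul]).

    - Spectral theory.  A self-adjoint element with nonnegative real spectrum is
      positive ([positive_of_aspectrum]): otherwise the least [m > 0] such that
      [b + m] is positive makes [b + m] invertible, hence bounded below, and [m]
      is not least.  With spectral mapping for polynomials this gives
      [||p(a)|| <= sup |p|] on the spectrum ([horner_alg_norm]), and the calculus
      extends from polynomials to their uniform limits.  The relation
      [represents a h c] says that [c] is the value [h(a)]; Weierstrass'
      theorem provides such a value for every continuous [h]
      ([calculus_hom]), and any *-homomorphism as in the definition of the
      functional calculus takes that value ([cfc_hom_represents]).

    - Hilbert modules.  The algebra [A] is a Hilbert module over itself for which
      the Cauchy-Schwarz inequality is plain, so [A] embeds isometrically in a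
      unital C*-algebra of operators by left multiplication, and the order
      theory applies to the values of inner products.  This yields the
      Cauchy-Schwarz inequality in every Hilbert module
      ([inner_cauchy_schwarz]), and then the adjointable operators of any nonzero
      Hilbert module form a unital C*-algebra. *)

Set Implicit Arguments.
Unset Strict Implicit.
Unset Printing Implicit Defensive.

Import Order.TTheory GRing.Theory Num.Theory.
Import numFieldNormedType.Exports.
Import ComplexField.Normc.

Local Open Scope classical_set_scope.
Local Open Scope ring_scope.
Local Open Scope complex_scope.

(** * Unital C*-algebras *)

(** The norm takes values in [R], not in [R[i]], and completeness is stated with
    epsilons, so that the algebraic theory needs no topology.  The last norm axiom is the
    half of the C*-identity that does not follow from submultiplicativity. *)
HB.mixin Record isUnitalCStar (R : realType) (B : Type)
    & GRing.Algebra R[i] B := {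
  unorm : B -> R;
  ustar : B -> B;
  unormD : forall a b, unorm (a + b) <= unorm a + unorm b;
  unormZ : forall (k : R[i]) a, unorm (k *: a) = normc k * unorm a;
  unormM : forall a b, unorm (a * b) <= unorm a * unorm b;
  unorm_eq0 : forall a, unorm a = 0 -> a = 0;
  ustarK : forall a, ustar (ustar a) = a;
  ustarD : forall a b, ustar (a + b) = ustar a + ustar b;
  ustarZ : forall (k : R[i]) a, ustar (k *: a) = conjc k *: ustar a;
  ustarM : forall a b, ustar (a * b) = ustar b * ustar a;
  unorm_star_ge : forall a, unorm a ^+ 2 <= unorm (ustar a * a);
  unorm_complete : forall u : nat -> B,
    (forall e, 0 < e -> exists N, forall m n, (N <= m)%N -> (N <= n)%N ->
       unorm (u m - u n) <= e) ->
    exists l, forall e, 0 < e -> exists N, forall n, (N <= n)%N ->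
       unorm (u n - l) <= e }.

#[short(type="unitalCStarType")]
HB.structure Definition UnitalCStar (R : realType) :=
  { B of isUnitalCStar R B & GRing.Algebra R[i] B }.

(** * Norms, adjoints and square roots *)

(** The form in which limits are taken below: a quantity that is [O(r)] for every
    [r > 0] is zero. *)
Lemma eq0_of_small (R : realType) (K u : R) :
  0 <= u -> (forall r, 0 < r -> u <= K * r) -> u = 0.
Proof.
move=> u0 small; apply/eqP; rewrite eq_le u0 andbT.
apply/ler_addgt0Pl => r r0; rewrite addr0.
have K0 : 0 < `|K| + 1 by rewrite ltr_pwDr.
have := small (r / (`|K| + 1)) (divr_gt0 r0 K0); move/le_trans; apply.
rewrite mulrCA ger_pMr // ler_pdivrMr // mul1r.
by rewrite (le_trans (ler_norm _)) ?lerDl.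
Qed.

Lemma scale2r (R : realType) (V : lmodType R[i]) (x : V) : (2 : R)%:C *: x = x + x.
Proof. by rewrite rmorph_nat scaler_nat mulr2n. Qed.

Section Majorized.
Variables (R : realType) (V : zmodType) (N : V -> R) (u : nat -> V) (s : nat -> R).
Hypotheses (N0 : N 0 = 0) (ND : forall x y, N (x + y) <= N x + N y).
Hypothesis NN : forall x, N (- x) = N x.
Hypothesis step : forall n, N (u n.+1 - u n) <= s n.+1 - s n.

Lemma majorized_dist n m : (n <= m)%N -> N (u m - u n) <= s m - s n.
Proof.
move=> /subnK <-; elim: (m - n)%N => [|k IH]; first by rewrite add0n !subrr N0.
rewrite addSn -(subrKA (u (k + n)%N)) (le_trans (ND _ _)) //.
by have := step (k + n)%N; move: IH; lra.
Qed.

(** The standard way of producing limits here: the increments of [u] are dominated by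
    those of a bounded scalar sequence [s], which is then nondecreasing. *)
Lemma majorized_cauchy M : (forall n, s n <= M) ->
  forall r, 0 < r -> exists k, forall m n, (k <= m)%N -> (k <= n)%N -> N (u m - u n) <= r.
Proof.
move=> s_le r r0; have supS : has_sup (range s).
  by split; [exists (s 0%N), 0%N|exists M => _ [n _ <-]].
have [_ [k _ <-] lt] := sup_adherent (divr_gt0 r0 (ltr0n _ 2)) supS.
have near n : (k <= n)%N -> N (u n - u k) <= r / 2.
  move=> /majorized_dist/le_trans; apply; have : s n <= sup (range s).
    by apply: sup_ubound; [case: supS|exists n].
  by lra.
exists k => m n /near hm /near hn; rewrite -(subrKA (u k)) (le_trans (ND _ _)) //.
by rewrite -(NN (u k - u n)) opprB; lra.
Qed.

End Majorized.

Section Order.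
Variables (R : realType) (B : unitalCStarType R).
Implicit Types (a b c d e x y z : B) (t s r : R).

Lemma normc_real t : normc (t%:C : R[i]) = `|t|.
Proof. by rewrite /= expr0n addr0 sqrtr_sqr. Qed.

Lemma unorm0 : unorm (0 : B) = 0.
Proof. by rewrite -[X in unorm X](scale0r (0 : B)) unormZ normc0 mul0r. Qed.

Lemma unormN a : unorm (- a) = unorm a.
Proof. by rewrite -scaleN1r unormZ normcN normc1 mul1r. Qed.

Lemma unormB a b : unorm (a - b) <= unorm a + unorm b.
Proof. by rewrite -(unormN b) unormD. Qed.

Lemma unorm_ge0 a : 0 <= unorm a.
Proof. by have := unormB a a; rewrite subrr unorm0; lra. Qed.

Lemma unorm_distC a b : unorm (a - b) = unorm (b - a).
Proof. by rewrite -unormN opprB. Qed.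

Lemma unorm_triangle b a c : unorm (a - c) <= unorm (a - b) + unorm (b - c).
Proof. by rewrite -[a - c](subrKA b) unormD. Qed.

Lemma unorm_small K a : (forall r, 0 < r -> unorm a <= K * r) -> a = 0.
Proof. by move=> small; apply/unorm_eq0/(eq0_of_small (unorm_ge0 a) small). Qed.

Lemma unormZr t a : unorm (t%:C *: a) = `|t| * unorm a.
Proof. by rewrite unormZ normc_real. Qed.

Lemma ustar_norm a : unorm (ustar a) = unorm a.
Proof.
have le b : unorm b <= unorm (ustar b).
  have [b0|b0] := eqVneq (unorm b) 0; first by rewrite b0 unorm_ge0.
  have bgt : 0 < unorm b by rewrite lt_neqAle eq_sym b0 unorm_ge0.
  by rewrite -(ler_pM2r bgt) -expr2 (le_trans (unorm_star_ge b)) ?unormM.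
by apply/eqP; rewrite eq_le le andbT -{2}(ustarK a) le.
Qed.

Lemma unorm_star a : unorm (ustar a * a) = unorm a ^+ 2.
Proof.
apply/eqP; rewrite eq_le unorm_star_ge andbT.
by rewrite (le_trans (unormM _ _)) // ustar_norm expr2.
Qed.

Lemma ustar1 : ustar (1 : B) = 1.
Proof. by rewrite -[RHS]ustarK -[X in _ = ustar X]mulr1 ustarM ustarK mulr1. Qed.

Lemma ustar0 : ustar (0 : B) = 0.
Proof. by apply: (addrI (ustar 0)); rewrite -ustarD !addr0. Qed.

Lemma ustarN a : ustar (- a) = - ustar a.
Proof. by apply: (addrI (ustar a)); rewrite -ustarD !subrr ustar0. Qed.

Lemma ustarB a b : ustar (a - b) = ustar a - ustar b.
Proof. by rewrite ustarD ustarN. Qed.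

Lemma ustarZr t a : ustar (t%:C *: a) = t%:C *: ustar a.
Proof. by rewrite ustarZ conjc_real. Qed.

Lemma unorm1 : unorm (1 : B) = 1.
Proof.
have := unorm_star 1; rewrite ustar1 mulr1 => /eqP.
rewrite -subr_eq0 expr2 -[X in X - _]mulr1 -mulrBr mulf_eq0 => /orP[|].
  by move=> /eqP/unorm_eq0/eqP; rewrite oner_eq0.
by rewrite subr_eq0 => /eqP.
Qed.


Definition self_adjoint a := ustar a = a.

Lemma self_adjointM d e : self_adjoint d -> self_adjoint e -> GRing.comm d e ->
  self_adjoint (d * e).
Proof. by move=> ds es de; rewrite /self_adjoint ustarM ds es. Qed.

Lemma self_adjointD d e : self_adjoint d -> self_adjoint e -> self_adjoint (d + e).
Proof. by move=> ds es; rewrite /self_adjoint ustarD ds es. Qed.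

Lemma self_adjointN d : self_adjoint d -> self_adjoint (- d).
Proof. by move=> ds; rewrite /self_adjoint ustarN ds. Qed.

Lemma self_adjointZ t d : self_adjoint d -> self_adjoint (t%:C *: d).
Proof. by move=> ds; rewrite /self_adjoint ustarZr ds. Qed.

Lemma self_adjoint1 : self_adjoint 1. Proof. exact: ustar1. Qed.
Lemma self_adjoint0 : self_adjoint 0. Proof. exact: ustar0. Qed.

Lemma self_adjoint_sqr_norm a : self_adjoint a -> unorm (a * a) = unorm a ^+ 2.
Proof. by move=> as_; rewrite -unorm_star as_. Qed.

Lemma ustar_mul_self_adjoint x : self_adjoint (ustar x * x).
Proof. by rewrite /self_adjoint ustarM ustarK. Qed.

Lemma majorized_cvg (u : nat -> B) (s : nat -> R) M :
  (forall n, unorm (u n.+1 - u n) <= s n.+1 - s n) -> (forall n, s n <= M) ->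
  exists l, forall r, 0 < r -> exists N, forall n, (N <= n)%N -> unorm (u n - l) <= r.
Proof.
by move=> step s_le; apply: unorm_complete;
   apply: (majorized_cauchy unorm0 unormD unormN step s_le).
Qed.

(** If [y] solves [2 y = c + y^2] then [(1 - y)^2 = 1 - c]; [sqrt_iter] is the
    fixed-point iteration for [y], and [sqrt_majorant] is the same iteration for the scalar
    [c = 1], whose fixed point is [1]. *)
Fixpoint sqrt_majorant n : R :=
  if n is n'.+1 then 2^-1 * (1 + sqrt_majorant n' ^+ 2) else 0.

Fixpoint sqrt_iter c n : B :=
  if n is n'.+1 then (2^-1 : R)%:C *: (c + sqrt_iter c n' * sqrt_iter c n') else 0.

Lemma sqrt_majorant_bounds n : 0 <= sqrt_majorant n <= 1.
Proof. by elim: n => [|n /= ]; rewrite ?lexx ?ler01 //; nra. Qed.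

Section SqrtIter.
Variable c : B.
Hypotheses (c_sa : self_adjoint c) (c_le1 : unorm c <= 1).
Let y := sqrt_iter c.

Lemma sqrt_iterS n : y n.+1 = (2^-1 : R)%:C *: (c + y n * y n).
Proof. by []. Qed.

Lemma sqrt_iter_norm n : unorm (y n) <= sqrt_majorant n.
Proof.
elim: n => [|n IH] /=; first by rewrite unorm0.
rewrite unormZr ger0_norm ?invr_ge0 ?ler0n // ler_pM2l ?invr_gt0 ?ltr0n //.
rewrite (le_trans (unormD _ _)) // lerD // (le_trans (unormM _ _)) //.
by rewrite expr2 ler_pM ?unorm_ge0.
Qed.

(** The iterates are polynomials in [c] whose successive differences have nonnegative
    coefficients, so they are dominated by their values at the scalar [1].  Here this appears
    as the factorisation of a difference of squares. *)
Lemma sqrt_iter_step n :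
  unorm (y n.+1 - y n) <= sqrt_majorant n.+1 - sqrt_majorant n.
Proof.
elim: n => [|n IH].
  rewrite /y /= mulr0 addr0 expr0n /= addr0 !subr0 unormZr.
  by rewrite ger0_norm ?invr_ge0 ?ler0n // ler_pM2l ?invr_gt0 ?ltr0n.
rewrite [y n.+2]sqrt_iterS [X in _ - X]sqrt_iterS -scalerBr opprD addrACA subrr add0r.
have -> : y n.+1 * y n.+1 - y n * y n = y n.+1 * (y n.+1 - y n) + (y n.+1 - y n) * y n.
  by rewrite mulrBr mulrBl addrA subrK.
rewrite unormZr ger0_norm ?invr_ge0 ?ler0n //.
have -> : 2^-1 * (1 + (2^-1 * (1 + sqrt_majorant n ^+ 2)) ^+ 2) -
    2^-1 * (1 + sqrt_majorant n ^+ 2) = 2^-1 *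
   (sqrt_majorant n.+1 * (sqrt_majorant n.+1 - sqrt_majorant n) +
    (sqrt_majorant n.+1 - sqrt_majorant n) * sqrt_majorant n) by rewrite /=; ring.
rewrite ler_pM2l ?invr_gt0 ?ltr0n // (le_trans (unormD _ _)) // lerD //.
  by rewrite (le_trans (unormM _ _)) // ler_pM ?unorm_ge0 ?sqrt_iter_norm.
by rewrite (le_trans (unormM _ _)) // ler_pM ?unorm_ge0 ?sqrt_iter_norm.
Qed.

Lemma sqrt_iter_comm x n : GRing.comm x c -> GRing.comm x (y n).
Proof.
move=> xc; elim: n => [|n IH]; first exact: commr0.
rewrite /GRing.comm /y /= -/y -scalerAl -scalerAr; congr (_ *: _).
by apply: commrD => //; apply: commrM.
Qed.

Lemma sqrt_iter_sa n : self_adjoint (y n).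
Proof.
elim: n => [|n IH]; first exact: self_adjoint0.
by apply/self_adjointZ/self_adjointD => //; apply: self_adjointM.
Qed.

(** Working with [||c|| <= 1] instead of [||c|| < 1] is essential: this is the
    boundary case used for positivity.  The commutation clause makes the square root usable
    together with any element commuting with [c]. *)
Lemma sqrt_one_minus : exists e, [/\ self_adjoint e, e * e = 1 - c,
  unorm (1 - e) <= 1 & forall x, GRing.comm x c -> GRing.comm x e].
Proof.
have [l lim] := majorized_cvg sqrt_iter_step
    (fun n => proj2 (andP (sqrt_majorant_bounds n))); exists (1 - l).
have lim1 r : 0 < r -> exists n, unorm (y n - l) <= r /\ unorm (y n.+1 - l) <= r.
  by move=> /lim[N HN]; exists N; split; apply: HN.
have yle1 n : unorm (y n) <= 1.
  by rewrite (le_trans (sqrt_iter_norm n)) //; case/andP: (sqrt_majorant_bounds n).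
have l_le1 : unorm l <= 1.
  apply/ler_addgt0Pl => r /lim1[n [nr _]].
  have := unorm_triangle (y n) l 0; rewrite !subr0 (unorm_distC l).
  by have := yle1 n; lra.
have l_sa : self_adjoint l.
  apply/eqP; rewrite -subr_eq0; apply/eqP; apply: (@unorm_small 2) => r /lim1[n [nr _]].
  rewrite (le_trans (unorm_triangle (y n) _ _)) // -{1}(sqrt_iter_sa n) -ustarB.
  by rewrite ustar_norm (unorm_distC l); move: nr; lra.
have l_eq : l + l = c + l * l.
  apply/eqP; rewrite -subr_eq0; apply/eqP; apply: (@unorm_small 4) => r /lim1[n [nr nr1]].
  have -> : l + l - (c + l * l) = (2 : R)%:C *: (l - y n.+1) +
      (y n * (y n - l) + (y n - l) * l).
    rewrite scalerBr sqrt_iterS scalerA -rmorphM /= divff ?pnatr_eq0 // scale1r scale2r.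
    by rewrite mulrBr mulrBl !opprD !addrA subrK subrK.
  rewrite (le_trans (unormD _ _)) // unormZr ger0_norm ?ler0n // (unorm_distC l).
  have h1 := le_trans (unormD (y n * (y n - l)) ((y n - l) * l)) (lerD (unormM _ _) (unormM _ _)).
  have := yle1 n; have := unorm_ge0 (y n); have := unorm_ge0 (y n - l); have := unorm_ge0 l.
  by move: h1 nr nr1 l_le1; nra.
split.
- exact/self_adjointD/self_adjointN/l_sa/self_adjoint1.
- have -> : c = l + l - l * l by rewrite l_eq addrK.
  by rewrite mulrBl mul1r mulrBr mulr1 !opprB opprD -addrA [- l + _]addrCA.
- by rewrite opprB addrC subrK.
- move=> x xc; apply: commrB; first exact: commr1.
  apply/eqP; rewrite -subr_eq0; apply/eqP.
  apply: (@unorm_small (2 * unorm x)) => r /lim1[n [nr _]].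
  have -> : x * l - l * x = x * (l - y n) - (l - y n) * x.
    by rewrite mulrBr mulrBl (sqrt_iter_comm n xc) opprB addrA subrK.
  rewrite (le_trans (unormB _ _)) //.
  have := unormM x (l - y n); have := unormM (l - y n) x.
  by move: nr; rewrite unorm_distC; have := unorm_ge0 x; nra.
Qed.

End SqrtIter.
End Order.

(** * Positive elements *)

Section Positive.
Variables (R : realType) (B : unitalCStarType R).
Implicit Types (a b c d e x y z : B) (t s r : R).

Definition scal t : B := t%:C *: 1.

Lemma scal_mull t a : scal t * a = t%:C *: a.
Proof. by rewrite /scal -scalerAl mul1r. Qed.

Lemma scal_mulr t a : a * scal t = t%:C *: a.
Proof. by rewrite /scal -scalerAr mulr1. Qed.

Lemma scalD t s : scal (t + s) = scal t + scal s.
Proof. by rewrite /scal rmorphD scalerDl. Qed.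

Lemma scalN t : scal (- t) = - scal t.
Proof. by rewrite /scal rmorphN scaleNr. Qed.

Lemma scalB t s : scal (t - s) = scal t - scal s.
Proof. by rewrite scalD scalN. Qed.

Lemma scal0 : scal 0 = 0.
Proof. by rewrite /scal scale0r. Qed.

Lemma scal_norm t : unorm (scal t) = `|t|.
Proof. by rewrite unormZr unorm1 mulr1. Qed.

Lemma scal_sa t : self_adjoint (scal t).
Proof. exact/self_adjointZ/self_adjoint1. Qed.

Lemma scal_comm x t : GRing.comm x (scal t).
Proof. by rewrite /GRing.comm scal_mull scal_mulr. Qed.

Lemma scale_sqrt2 t a : 0 <= t ->
  (Num.sqrt t)%:C *: ((Num.sqrt t)%:C *: a) = t%:C *: a.
Proof. by move=> t0; rewrite scalerA -rmorphM -expr2 sqr_sqrtr. Qed.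

Lemma sqrt_scal_sub c t : self_adjoint c -> unorm c <= t ->
  exists e, [/\ self_adjoint e, e * e = scal t - c,
    unorm (scal (Num.sqrt t) - e) <= Num.sqrt t &
    forall x, GRing.comm x c -> GRing.comm x e].
Proof.
move=> c_sa c_le; have [t_gt0|t_lt0|tE] := ltgtP 0 t; last 2 first.
- by have := unorm_ge0 c; lra.
- have -> : c = 0.
    by apply: unorm_eq0; have := unorm_ge0 c; move: c_le; rewrite -tE; lra.
  exists 0; rewrite -tE sqrtr0 scal0 !subr0 mulr0 unorm0; split=> //.
  exact: self_adjoint0.
have [||e [e_sa e2 e_near e_comm]] := @sqrt_one_minus _ _ (t^-1%:C *: c).
- exact: self_adjointZ.
- by rewrite unormZr gtr0_norm ?invr_gt0 // mulrC ler_pdivrMr // mul1r.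
exists ((Num.sqrt t)%:C *: e); split.
- exact: self_adjointZ.
- rewrite -scalerAl -scalerAr scale_sqrt2 ?(ltW t_gt0) // e2.
  by rewrite scalerBr scalerA -rmorphM divff ?gt_eqF // scale1r.
- by rewrite -scalerBr unormZr ger0_norm ?sqrtr_ge0 // ger_pMr ?sqrtr_gt0.
- move=> x xc; rewrite /GRing.comm -scalerAr -scalerAl e_comm //.
  by rewrite /GRing.comm -scalerAr -scalerAl xc.
Qed.

Lemma conjc_i : conjc 'i = - 'i :> R[i].
Proof. by apply/eqP; rewrite eq_complex /= oppr0 !eqxx. Qed.

Lemma mulCii : 'i * 'i = -1 :> R[i].
Proof. by rewrite -expr2 sqr_i. Qed.

(** With [u = d + i e], commutation gives [u^* u = d^2 + e^2], while [d] is the mean of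
    [u] and [u^*], so [||d|| <= ||u||]. *)
Lemma norm_sqr_le_add d e : self_adjoint d -> self_adjoint e ->
  GRing.comm d e -> unorm (d * d) <= unorm (d * d + e * e).
Proof.
move=> d_sa e_sa de; pose u := d + 'i *: e.
have uE : ustar u = d - 'i *: e.
  by rewrite /u ustarD ustarZ d_sa e_sa conjc_i scaleNr.
have uu : ustar u * u = d * d + e * e.
  rewrite uE mulrDr !mulrBl -!scalerAl -!scalerAr scalerA mulCii de scaleN1r.
  by rewrite opprK addrA subrK.
have d_le : unorm d <= unorm u.
  have -> : d = (2^-1 : R)%:C *: (u + ustar u).
    by rewrite uE addrACA subrr addr0 -scale2r scalerA -rmorphM mulVf ?pnatr_eq0 // scale1r.
  rewrite unormZr ger0_norm ?invr_ge0 ?ler0n //.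
  by have := unormD u (ustar u); rewrite ustar_norm; lra.
by rewrite -uu unorm_star self_adjoint_sqr_norm // ler_sqr ?nnegrE ?unorm_ge0.
Qed.

Definition positive a := exists2 e, self_adjoint e & a = e * e.

Lemma positive_sa a : positive a -> self_adjoint a.
Proof. by move=> [e es ->]; apply: self_adjointM. Qed.

(** Take [f] with [f^2 = t - a]: it commutes with a root of [a], and
    [||f^2|| <= ||f^2 + a|| = t]. *)
Lemma positive_norm_sub a t : positive a -> unorm a <= t -> unorm (scal t - a) <= t.
Proof.
move=> a_pos; have a_sa := positive_sa a_pos; case: a_pos => e e_sa aE a_le.
have [f [f_sa f2 _ f_comm]] := sqrt_scal_sub a_sa a_le.
have t0 : 0 <= t := le_trans (unorm_ge0 a) a_le.
have fe : GRing.comm f e.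
  by apply/commr_sym/f_comm; rewrite aE /GRing.comm mulrA.
have := norm_sqr_le_add f_sa e_sa fe.
by rewrite f2 -aE subrK scal_norm ger0_norm.
Qed.

(** Converse of [positive_norm_sub]: [a = t - (t - a)] has a square root because
    [||t - a|| <= t]. *)
Lemma sqrt_near_scal a t : self_adjoint a -> unorm (scal t - a) <= t ->
  exists e, [/\ self_adjoint e, e * e = a,
    unorm (scal (Num.sqrt t) - e) <= Num.sqrt t &
    forall x, GRing.comm x a -> GRing.comm x e].
Proof.
move=> a_sa a_near.
have c_sa : self_adjoint (scal t - a).
  by apply/self_adjointD/self_adjointN => //; exact: scal_sa.
have [e [e_sa e2 e_near e_comm]] := sqrt_scal_sub c_sa a_near.
exists e; split=> //; first by rewrite e2 opprB addrC subrK.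
by move=> x xa; apply: e_comm; apply: commrB => //; exact: scal_comm.
Qed.

Lemma positive_of_norm_sub a t :
  self_adjoint a -> unorm (scal t - a) <= t -> positive a.
Proof. by move=> a_sa /(sqrt_near_scal a_sa)[e [e_sa <- _ _]]; exists e. Qed.

Lemma positive_sqrt a : positive a ->
  exists e, [/\ positive e, e * e = a & forall x, GRing.comm x a -> GRing.comm x e].
Proof.
move=> a_pos; have a_sa := positive_sa a_pos.
have [e [e_sa e2 e_near e_comm]] :=
  sqrt_near_scal a_sa (positive_norm_sub a_pos (lexx _)).
by exists e; split=> //; apply: positive_of_norm_sub e_near.
Qed.

Lemma positive_sqr e : self_adjoint e -> positive (e * e).
Proof. by exists e. Qed.

Lemma positive_scal t : 0 <= t -> positive (scal t).
Proof.
move=> t0; exists (scal (Num.sqrt t)); first exact: scal_sa.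
by rewrite scal_mull scale_sqrt2.
Qed.

(** By [positive_norm_sub] positivity is a norm condition which is stable under
    addition by the triangle inequality. *)
Lemma positiveD a b : positive a -> positive b -> positive (a + b).
Proof.
move=> a_pos b_pos; apply: (@positive_of_norm_sub _ (unorm a + unorm b)).
  by apply: self_adjointD; exact: positive_sa.
by rewrite scalD opprD addrACA (le_trans (unormD _ _)) // lerD ?positive_norm_sub.
Qed.

Lemma positiveZ t a : 0 <= t -> positive a -> positive (t%:C *: a).
Proof.
move=> t0 [e e_sa ->]; exists ((Num.sqrt t)%:C *: e); first exact: self_adjointZ.
by rewrite -scalerAl -scalerAr scale_sqrt2.
Qed.

Lemma positive_closed a : (forall r, 0 < r -> positive (a + scal r)) -> positive a.
Proof.
move=> a_pos; have a_sa : self_adjoint a.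
  rewrite -(addrK (scal 1) a); apply/self_adjointD/self_adjointN/scal_sa.
  exact/positive_sa/a_pos.
apply: (@positive_of_norm_sub _ (unorm a + 1)) => //.
apply/ler_addgt0Pl => r r0; pose s := Num.min r 1.
have s0 : 0 < s by rewrite lt_min r0 ltr01.
have [sr s1] : s <= r /\ s <= 1 by rewrite !ge_min !lexx orbT.
have : unorm (a + scal s) <= unorm a + 1.
  by rewrite (le_trans (unormD _ _)) // scal_norm gtr0_norm // lerD.
move=> /(positive_norm_sub (a_pos s s0)) near.
have -> : scal (unorm a + 1) - a = scal (unorm a + 1) - (a + scal s) + scal s.
  by rewrite opprD addrA subrK.
by rewrite (le_trans (unormD _ _)) // addrC lerD // scal_norm gtr0_norm.
Qed.

(** Both [a = d^2] and [t - a = e^2] are squares of commuting elements, so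
    [||a|| <= ||a + (t - a)|| = t]. *)
Lemma positive_le_norm a t : 0 <= t ->
  positive a -> positive (scal t - a) -> unorm a <= t.
Proof.
move=> t0 [d d_sa aE] /positive_sqrt[e [e_pos e2 e_comm]].
have de : GRing.comm d e.
  apply: e_comm; apply: commrB; first exact: scal_comm.
  by rewrite aE /GRing.comm mulrA.
have := norm_sqr_le_add d_sa (positive_sa e_pos) de.
by rewrite e2 -aE addrC subrK scal_norm ger0_norm.
Qed.

Lemma positive_anti a : positive a -> positive (- a) -> a = 0.
Proof.
move=> a_pos na_pos; apply: unorm_eq0; apply/eqP.
by rewrite eq_le unorm_ge0 andbT positive_le_norm // scal0 sub0r.
Qed.

Lemma positive_sub_of_norm a t : self_adjoint a -> unorm a <= t ->
  positive (scal t - a).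
Proof. by move=> a_sa /(sqrt_scal_sub a_sa)[e [e_sa <- _ _]]; exists e. Qed.

Lemma self_adjoint_sqr_eq0 a : self_adjoint a -> a * a = 0 -> a = 0.
Proof.
move=> a_sa a2; apply: unorm_eq0; apply/eqP.
by rewrite -sqrf_eq0 -self_adjoint_sqr_norm // a2 unorm0.
Qed.

Lemma ustar_mul_eq0 x : ustar x * x = 0 -> x = 0.
Proof.
move=> xx; apply: unorm_eq0; apply/eqP.
by rewrite -sqrf_eq0 -unorm_star xx unorm0.
Qed.

(** With [x = h + i k], the sum is [2 (h^2 + k^2)]. *)
Lemma positive_ustar_mul_add x : positive (ustar x * x + x * ustar x).
Proof.
pose h := x + ustar x; pose k := 'i *: (x - ustar x).
have h_sa : self_adjoint h by rewrite /self_adjoint ustarD ustarK addrC.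
have k_sa : self_adjoint k.
  rewrite /self_adjoint ustarZ ustarB ustarK conjc_i.
  by rewrite scaleNr -scalerN opprB.
have hE : h * h = (x * x + ustar x * ustar x) + (ustar x * x + x * ustar x).
  by rewrite mulrDr !mulrDl [x * ustar x + _]addrC addrACA.
have kE : k * k = (ustar x * x + x * ustar x) - (x * x + ustar x * ustar x).
  rewrite /k -scalerAl -scalerAr scalerA mulCii scaleN1r mulrBr !mulrBl.
  by rewrite !opprB addrC opprD [RHS]addrACA.
have -> : ustar x * x + x * ustar x = (2^-1 : R)%:C *: (h * h + k * k).
  rewrite [h * h + _]addrC hE kE addrA subrK -scale2r scalerA -rmorphM mulVf ?pnatr_eq0 //.
  by rewrite scale1r.
apply: positiveZ; first by rewrite invr_ge0 ler0n.
by apply: positiveD; exact: positive_sqr.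
Qed.

(** For [w = y z] the elements [w^* w] and [w w^*] are the opposites of the squares of [z^2] and
    [y y^*], but their sum is positive, so both vanish.  This replaces the usual comparison of the
    spectra of [y^* y] and [y y^*]. *)
Lemma ustar_mul_neg_sqr y z : self_adjoint z -> ustar y * y = - (z * z) -> y = 0.
Proof.
move=> z_sa yE; pose w := y * z.
have wE : ustar w * w = - (z * z * (z * z)).
  by rewrite /w ustarM z_sa !mulrA -(mulrA z (ustar y) y) yE mulrN mulNr !mulrA.
have wE' : w * ustar w = - (y * ustar y * (y * ustar y)).
  by rewrite /w ustarM z_sa !mulrA -(mulrA y (ustar y) y) yE mulrN mulNr !mulrA opprK.
have z2 : positive (z * z * (z * z)) by apply/positive_sqr/self_adjointM.
have y2 : positive (y * ustar y * (y * ustar y)).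
  by apply: positive_sqr; rewrite /self_adjoint ustarM ustarK.
have sum0 := positive_anti (positive_ustar_mul_add w).
have {sum0} w0 : ustar w * w = - (w * ustar w).
  apply/eqP; rewrite -addr_eq0 sum0 // wE wE' opprD !opprK; exact: positiveD.
have /self_adjoint_sqr_eq0 : z * z * (z * z) = 0.
  by apply: positive_anti; rewrite // -wE w0 wE' opprK.
move=> zz0; have {zz0} zz0 := zz0 (self_adjointM z_sa z_sa erefl).
by apply: ustar_mul_eq0; rewrite yE zz0 oppr0.
Qed.

(** Here [r = |a|] and [k = |a| - a] is twice the negative part of [a].  One computes
    [k a k = - r k^2], the opposite of a square; if it must vanish then so does [k],
    and [a = |a|].  Both [x^* x] in a C*-algebra and [T^* T] for an operator between two
    modules are treated with this criterion. *)
Lemma positive_of_no_negative_compression a : self_adjoint a ->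
  (forall k z, self_adjoint k -> self_adjoint z -> k * a * k = - (z * z) -> z = 0) ->
  positive a.
Proof.
move=> a_sa neg.
have [r [r_pos r2 r_comm]] := positive_sqrt (positive_sqr a_sa).
have [s [s_pos s2 s_comm]] := positive_sqrt r_pos.
have r_sa := positive_sa r_pos; have s_sa := positive_sa s_pos.
have ar : GRing.comm a r by apply: r_comm; rewrite /GRing.comm mulrA.
have as_ : GRing.comm a s by exact: s_comm.
have rs : GRing.comm r s by exact: s_comm.
pose k := r - a.
have k_sa : self_adjoint k by exact/self_adjointD/self_adjointN/a_sa.
have sk : GRing.comm s k by apply: commrB; exact: commr_sym.
have ak : a * k = - (r * k).
  by rewrite !mulrBr r2 ar opprB.
have /neg-/(_ k_sa) : k * a * k = - (s * k * (s * k)).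
  by rewrite -mulrA ak mulrN -s2 {1}sk !mulrA.
move=> /(_ (self_adjointM s_sa k_sa sk)) sk0.
have rk0 : r * k = 0 by rewrite -s2 -mulrA sk0 mulr0.
have k0 : k = 0.
  by apply: self_adjoint_sqr_eq0 => //; rewrite {1}/k mulrBl ak rk0 oppr0 subr0.
by move/eqP: k0; rewrite /k subr_eq0 => /eqP <-.
Qed.

(** The compression [k x^* x k] is [(x k)^* (x k)], which is not the opposite of a
    nonzero square by [ustar_mul_neg_sqr]. *)
Theorem positive_ustar_mul x : positive (ustar x * x).
Proof.
apply: positive_of_no_negative_compression; first exact: ustar_mul_self_adjoint.
move=> k z k_sa z_sa kz.
have y0 : x * k = 0.
  apply: (ustar_mul_neg_sqr z_sa); by rewrite ustarM k_sa -kz !mulrA.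
apply: self_adjoint_sqr_eq0 => //; apply/eqP.
by rewrite -oppr_eq0 -kz mulrA -mulrA y0 mulr0.
Qed.

Lemma positive_compress a x : positive a -> positive (ustar x * a * x).
Proof.
move=> [e e_sa ->]; have -> : ustar x * (e * e) * x = ustar (e * x) * (e * x).
  by rewrite ustarM e_sa !mulrA.
exact: positive_ustar_mul.
Qed.

End Positive.

(** * Invertibility and the spectrum *)

Section Spectrum.
Variables (R : realType) (B : unitalCStarType R).
Implicit Types (a b c d e x y z : B) (t s r : R) (l : R[i]).

Definition invertible a := exists s : B, s * a = 1 /\ a * s = 1.

(** The partial sums of the geometric series are produced by [u n.+1 = 1 + c u n], and
    dominated by the scalar sequence with ratio [||c||]. *)
Lemma neumann c : unorm c < 1 -> invertible (1 - c).
Proof.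
move=> c1; pose q := unorm c; have q0 : 0 <= q := unorm_ge0 c.
have [u u0 uS] : exists2 u : nat -> B, u 0%N = 0 & forall n, u n.+1 = 1 + c * u n.
  by exists (fun n => iter n (fun y => 1 + c * y) 0).
have [s s0 sS] : exists2 s : nat -> R, s 0%N = 0 & forall n, s n.+1 = 1 + q * s n.
  by exists (fun n => iter n (fun w => 1 + q * w) 0).
have step n : unorm (u n.+1 - u n) <= s n.+1 - s n.
  elim: n => [|n IH].
    by rewrite uS sS u0 s0 !mulr0 !addr0 !subr0 unorm1.
  rewrite uS [X in _ - X]uS sS [X in _ <= _ - X]sS.
  rewrite opprD addrACA subrr add0r -mulrBr.
  have -> : 1 + q * s n.+1 - (1 + q * s n) = q * (s n.+1 - s n) by ring.
  by rewrite (le_trans (unormM _ _)) // ler_wpM2l.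
have s_le n : s n <= (1 - q)^-1.
  have p0 : 0 < 1 - q by rewrite subr_gt0.
  elim: n => [|n IH]; rewrite ?s0 ?sS; first by rewrite invr_ge0 ltW.
  have -> : (1 - q)^-1 = 1 + q * (1 - q)^-1.
    by rewrite -{2}(mulfV (lt0r_neq0 p0)) -mulrDl subrK mul1r.
  by rewrite lerD2l ler_wpM2l.
have [v lim] := majorized_cvg step s_le.
have uc n : u n * c = c * u n.
  elim: n => [|n IH]; first by rewrite u0 mulr0 mul0r.
  by rewrite uS mulrDl mulrDr mul1r mulr1 -mulrA IH.
have lim1 r : 0 < r -> exists n, unorm (u n - v) <= r /\ unorm (u n.+1 - v) <= r.
  by move=> /lim[N HN]; exists N; split; apply: HN.
have cv : (1 - c) * v = 1.
  apply/eqP; rewrite -subr_eq0; apply/eqP; apply: (@unorm_small _ _ 2) => r /lim1[n [h1 h2]].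
  have -> : (1 - c) * v - 1 = (v - u n.+1) + c * (u n - v).
    by rewrite uS mulrBl mul1r mulrBr opprD !addrA subrK addrAC.
  rewrite (le_trans (unormD _ _)) // (unorm_distC v).
  have := unormM c (u n - v); have := unorm_ge0 (u n - v); move: h1 h2 c1; rewrite -/q; nra.
have vc : v * c = c * v.
  apply/eqP; rewrite -subr_eq0; apply/eqP; apply: (@unorm_small _ _ 2) => r /lim1[n [h1 _]].
  have -> : v * c - c * v = c * (u n - v) - (u n - v) * c.
    by rewrite mulrBr mulrBl uc opprB [RHS]addrC addrA subrK.
  rewrite (le_trans (unormB _ _)) //.
  have := unormM c (u n - v); have := unormM (u n - v) c.
  by have := unorm_ge0 (u n - v); move: h1 c1; rewrite -/q; nra.
by exists v; split=> //; rewrite mulrBr mulr1 vc -[X in X - _]mul1r -mulrBl.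
Qed.

Lemma invertibleM a b : invertible a -> invertible b -> invertible (a * b).
Proof.
move=> [s [sa as_]] [t [tb bt]]; exists (t * s); split.
  by rewrite -mulrA (mulrA s) sa mul1r.
by rewrite -mulrA (mulrA b) bt mul1r.
Qed.

Lemma invertibleZ k a : k != 0 -> invertible a -> invertible (k *: a).
Proof.
move=> k0 [s [sa as_]]; exists (k^-1 *: s); rewrite -!scalerAl -!scalerAr !scalerA.
by rewrite sa as_ mulfV // mulVf // !scale1r.
Qed.

Lemma invertibleN a : invertible (- a) -> invertible a.
Proof.
move=> [s [sa as_]]; exists (- s); split.
  by rewrite mulNr -mulrN.
by rewrite mulrN -mulNr.
Qed.

Lemma invertible_commMl x y : GRing.comm x y -> invertible (x * y) -> invertible x.
Proof.
move=> xy [s [sx xs]]; have xys : x * (y * s) = 1 by rewrite mulrA.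
have syx : s * y * x = 1 by rewrite -mulrA -xy.
exists (y * s); split => //; rewrite -[LHS]mul1r -syx.
by rewrite -!mulrA (mulrA x y) (mulrA (x * y)) xs mul1r !mulrA syx.
Qed.

Lemma invertible_scal_sub c t : unorm c < t -> invertible (scal B t - c).
Proof.
move=> ct; have t0 : 0 < t := le_lt_trans (unorm_ge0 c) ct.
have -> : scal B t - c = t%:C *: (1 - t^-1%:C *: c).
  by rewrite scalerBr scalerA -rmorphM mulfV ?gt_eqF // scale1r.
apply: invertibleZ; first by rewrite (inj_eq (@complexI _)) gt_eqF.
by apply: neumann; rewrite unormZr gtr0_norm ?invr_gt0 // mulrC ltr_pdivrMr // mul1r.
Qed.

Lemma invertible_open a : invertible a ->
  exists2 d, 0 < d & forall c, unorm c < d -> invertible (a - c).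
Proof.
move=> a_inv; have [s [sa as_]] := a_inv.
have s0 : 0 < unorm s + 1 by rewrite ltr_wpDl ?unorm_ge0.
exists (unorm s + 1)^-1 => [|c cd]; first by rewrite invr_gt0.
have -> : a - c = a * (1 - s * c) by rewrite mulrBr mulr1 mulrA as_ mul1r.
apply: invertibleM => //; apply: neumann.
apply: le_lt_trans (unormM _ _) _.
have : (unorm s + 1) * unorm c < 1 by rewrite -ltr_pdivlMl // mulr1.
by have := unorm_ge0 c; lra.
Qed.

(** Then [||(t + r) - a|| <= t < t + r], where [t] is the norm of [a - r]. *)
Lemma invertible_of_positive a r : 0 < r -> positive (a - scal B r) -> invertible a.
Proof.
move=> r0 a_pos; have := positive_norm_sub a_pos (lexx _).
set t := unorm (a - _); rewrite opprB addrA -scalD => near.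
have /invertible_scal_sub : unorm (scal B (t + r) - a) < t + r.
  by rewrite (le_lt_trans near) // ltrDl.
by rewrite opprB addrC subrK.
Qed.

(** If [b] is the inverse of [a = e^2] and [b <= M], then [1 = e b e <= M a]. *)
Lemma positive_invertible a : positive a -> invertible a ->
  exists2 r, 0 < r & positive (a - scal B r).
Proof.
move=> a_pos [b [ba ab]]; have a_sa := positive_sa a_pos.
have [e [e_pos e2 e_comm]] := positive_sqrt a_pos.
have e_sa := positive_sa e_pos.
have b_sa : self_adjoint b.
  rewrite /self_adjoint -[LHS]mulr1 -{1}ab mulrA -{1}a_sa -ustarM ab.
  by rewrite ustar1 mul1r.
have M0 : 0 < unorm b + 1 by rewrite ltr_wpDl ?unorm_ge0.
have ebe : e * b * e = 1.
  have eb : e * b = b * e.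
    have ea : e * a = a * e by apply/esym/e_comm.
    by rewrite -[LHS]mul1r -{1}ba -!mulrA (mulrA a) -ea -!mulrA ab mulr1.
  by rewrite eb -mulrA e2.
have := @positive_sub_of_norm _ _ b (unorm b + 1) b_sa; rewrite lerDl ler01 => /(_ isT).
move=> /(positive_compress e); rewrite e_sa mulrBr mulrBl ebe scal_mulr -scalerAl e2.
move=> /(positiveZ (t := (unorm b + 1)^-1)); rewrite invr_ge0 ltW // => /(_ isT).
rewrite scalerBr scalerA -rmorphM mulVf ?gt_eqF // scale1r => pos.
by exists (unorm b + 1)^-1 => //; rewrite invr_gt0.
Qed.

Lemma mulrBD_comm x y : GRing.comm x y -> (x - y) * (x + y) = x * x - y * y.
Proof. by move=> xy; rewrite mulrDr !mulrBl -xy addrA subrK. Qed.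

(** In contrast with [spectrum], this is formulated in an abstract algebra; see
    [spectrumP] for the agreement of the two on operators. *)
Definition aspectrum a : set R[i] := [set l | ~ invertible (a - l *: 1)].

(** For [l = s + i t] the product of [a - l] with its conjugate is
    [(a - s)^2 + t^2], which is bounded below by [t^2 > 0]. *)
Lemma invertible_sub_nonreal a l : self_adjoint a -> complex.Im l != 0 ->
  invertible (a - l *: 1).
Proof.
case: l => s t /= a_sa t0.
have st : (s +i* t : R[i]) *: 1 = scal B s + t%:C *: ('i *: 1) :> B.
  rewrite /scal scalerA -scalerDl; congr (_ *: _); apply/eqP.
  by rewrite eq_complex /=; apply/andP; split; apply/eqP; ring.
pose b := a - scal B s; pose k := t%:C *: ('i *: 1 : B).
have b_sa : self_adjoint b by apply/self_adjointD/self_adjointN/scal_sa.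
have bk : GRing.comm b k by rewrite /GRing.comm /k -!scalerAr -!scalerAl mulr1 mul1r.
rewrite st opprD addrA -/b -/k.
apply: (@invertible_commMl _ (b + k)).
  by apply/commr_sym/commrB; apply/commr_sym/commrD => //; exact: commr_sym.
have -> : (b - k) * (b + k) = b * b + scal B (t ^+ 2).
  rewrite mulrBD_comm //; congr (_ + _).
  rewrite /k /scal -!scalerAl mul1r !scalerA -scaleNr; congr (_ *: _).
  by apply/eqP; rewrite eq_complex /=; apply/andP; split; apply/eqP; ring.
apply: (@invertible_of_positive _ (t ^+ 2)); first by rewrite exprn_even_gt0.
by rewrite addrK; exact: positive_sqr.
Qed.

Lemma aspectrum_real a l : self_adjoint a -> aspectrum a l ->
  l = (complex.Re l)%:C.
Proof.
move=> a_sa; case: l => s t; have [->//|t0] := eqVneq t 0.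
by case; apply: invertible_sub_nonreal.
Qed.

Lemma aspectrum_le_norm a t : aspectrum a t%:C -> t <= unorm a.
Proof.
move=> spec; rewrite leNgt; apply/negP => at_; apply: spec.
by apply: invertibleN; rewrite opprB; exact: invertible_scal_sub.
Qed.

Lemma aspectrum_positive a t : positive a -> aspectrum a t%:C -> 0 <= t.
Proof.
move=> a_pos spec; rewrite leNgt; apply/negP => t0; apply: spec.
apply: (@invertible_of_positive _ (- t)); first by rewrite oppr_gt0.
by rewrite scalN opprK subrK.
Qed.

(** Let [m] be the infimum of the [t >= 0] such that [a + t] is positive; it is
    attained.  If [m > 0] then [- m] is not in the spectrum, so [a + m] is invertible and
    positive, hence bounded below by some [r > 0], which contradicts the choice of [m]. *)
Lemma positive_of_aspectrum a : self_adjoint a ->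
  (forall t, aspectrum a t%:C -> 0 <= t) -> positive a.
Proof.
move=> a_sa spec; pose S := [set t : R | 0 <= t /\ positive (a + scal B t)].
have S_inf : has_inf S.
  split; last by exists 0 => t [].
  exists (unorm a); split; first exact: unorm_ge0.
  rewrite addrC -[X in _ + X]opprK; apply: positive_sub_of_norm; first exact: self_adjointN.
  by rewrite unormN.
have m0 : 0 <= inf S by apply: lb_le_inf; [case: S_inf|move=> t []].
have m_pos : positive (a + scal B (inf S)).
  apply: positive_closed => r r0; have [t [t0 t_pos] tr] := inf_adherent r0 S_inf.
  have -> : a + scal B (inf S) + scal B r = a + scal B t + scal B (inf S + r - t).
    by rewrite -!addrA -!scalD; congr (_ + scal _ _); ring.
  by apply: positiveD => //; apply: positive_scal; move: tr; lra.
move: m0; rewrite le_eqVlt => /predU1P[m0|m_gt0].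
  by move: m_pos; rewrite -m0 scal0 addr0.
have inv : invertible (a + scal B (inf S)).
  apply: contrapT => ninv; suff : 0 <= - inf S by rewrite oppr_ge0 leNgt m_gt0.
  by apply: spec => minv; apply: ninv; move: minv; rewrite rmorphN scaleNr opprK.
have [r r0 r_pos] := positive_invertible m_pos inv.
pose s := Num.min r (inf S).
have [sr sm] : s <= r /\ s <= inf S by rewrite !ge_min !lexx orbT.
have s0 : 0 < s by rewrite lt_min r0.
have : S (inf S - s).
  split; first by rewrite subr_ge0.
  have -> : a + scal B (inf S - s) = a + scal B (inf S) - scal B r + scal B (r - s).
    by rewrite !scalB !addrA subrK.
  by apply: positiveD => //; apply: positive_scal; rewrite subr_ge0.
by move=> /(inf_lbound (proj2 S_inf)); lra.
Qed.

(** Otherwise [a - t] would be positive for all [t], in particular for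
    [t = ||a|| + 1], while [||a|| - a] is positive too. *)
Lemma aspectrum_nonempty a : self_adjoint a -> exists l, aspectrum a l.
Proof.
move=> a_sa; apply: contrapT => /forallNP none; pose t := unorm a + 1.
have pos1 : positive (a - scal B t).
  apply: positive_of_aspectrum; first exact/self_adjointD/self_adjointN/scal_sa.
  move=> s spec; case: (none (t + s)%:C) => inv; apply: spec.
  by rewrite -addrA -opprD -[s%:C *: 1]/(scal B s) -scalD.
have pos2 : positive (scal B (unorm a) - a) by exact: positive_sub_of_norm.
have := positiveD pos1 pos2; rewrite addrC subrKA /t scalD opprD addrA subrr add0r.
move=> /(positive_anti (positive_scal B ler01))/(congr1 (@unorm _ B)).
by rewrite scal_norm unorm0 normr1 => /eqP; rewrite oner_eq0.
Qed.

End Spectrum.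

(** * Polynomial calculus and its uniform limits *)

Section Approximation.
Variables (R : realType) (B : unitalCStarType R).
Implicit Types (b c d e x y z : B) (t s r : R) (l : R[i]) (p q : {poly R[i]}).
Implicit Types (h k : R[i] -> R[i]).

Lemma normc_ge0 l : 0 <= normc l.
Proof. by case: l => s t; exact: sqrtr_ge0. Qed.

Lemma normc_distC l1 l2 : normc (l1 - l2) = normc (l2 - l1).
Proof. by rewrite -normcN opprB. Qed.

Lemma normc_triangle l2 l1 l3 : normc (l1 - l3) <= normc (l1 - l2) + normc (l2 - l3).
Proof. by rewrite -[l1 - l3](subrKA l2); exact: le_normcD. Qed.

Lemma normcJ_mul l : conjc l * l = (normc l ^+ 2)%:C.
Proof.
case: l => s t /=; rewrite sqr_sqrtr ?addr_ge0 ?sqr_ge0 //.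
by apply/eqP; rewrite eq_complex /=; apply/andP; split; apply/eqP; ring.
Qed.

Lemma normc_conj l : normc (conjc l) = normc l.
Proof. by case: l => s t /=; rewrite sqrrN. Qed.

Lemma horner_normc_bounded p s : exists M, forall l, normc l <= s -> normc p.[l] <= M.
Proof.
elim/poly_ind: p => [|p c [M pM]].
  by exists 0 => l _; rewrite horner0 normc0.
exists (M * s + normc c) => l ls; rewrite hornerMXaddC.
rewrite (le_trans (le_normcD _ _)) // lerD2r normcM.
by rewrite ler_pM ?normc_ge0 // pM.
Qed.

Section SelfAdjoint.
Variable a : B.
Hypothesis a_sa : self_adjoint a.
Let sp := aspectrum a.

Lemma horner_alg_commr p : a * horner_alg a p = horner_alg a p * a.
Proof.
by rewrite -[X in X * _](horner_algX a) -rmorphM mulrC rmorphM /= horner_algX.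
Qed.

Lemma horner_alg_star p :
  ustar (horner_alg a p) = horner_alg a (map_poly conjc p).
Proof.
elim/poly_ind: p => [|p c IH]; first by rewrite rmorph0 !raddf0 ustar0.
rewrite !rmorphD !rmorphM /= map_polyX map_polyC /= !horner_algX !horner_algC.
by rewrite ustarD ustarM a_sa IH ustarZ ustar1 horner_alg_commr.
Qed.

Lemma horner_map_conjc p l : sp l -> (map_poly conjc p).[l] = conjc p.[l].
Proof. by move=> /(aspectrum_real a_sa) ->; rewrite -{1}conjc_real horner_map. Qed.

Lemma aspectrum_normc l : sp l -> normc l <= unorm a.
Proof.
move=> spl; have lE := aspectrum_real a_sa spl; rewrite lE normc_real ler_norml.
rewrite lE in spl; apply/andP; split; last exact: aspectrum_le_norm spl.
rewrite lerNl -(unormN a); apply: aspectrum_le_norm => inv; apply: spl.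
by apply: invertibleN; move: inv; rewrite opprB rmorphN scaleNr opprK addrC.
Qed.

(** Factor [p - l] over the complex numbers: if no root were in the spectrum of [a],
    then [p(a) - l] would be a product of invertible elements.  The constant case needs a
    point of the spectrum. *)
Lemma aspectrum_mapping p l : aspectrum (horner_alg a p) l ->
  exists2 m, sp m & p.[m] = l.
Proof.
move=> spec; have [r rE] := closed_field_poly_normal (p - l%:P).
have [lead0|lead0] := eqVneq (lead_coef (p - l%:P)) 0.
  have [m spm] := aspectrum_nonempty a_sa; exists m => //.
  move/eqP: lead0; rewrite lead_coef_eq0 subr_eq0 => /eqP ->; exact: hornerC.
apply: contrapT => none; apply: spec.
have -> : horner_alg a p - l *: 1 = horner_alg a (p - l%:P).
  by rewrite rmorphB /= horner_algC.
rewrite rE linearZ /= mulr_algl; apply: invertibleZ => //.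
have rP m : m \in r -> invertible (a - m *: 1).
  move=> mr; apply: contrapT => spm; apply: none; exists m => //.
  apply/eqP; rewrite -subr_eq0 -(hornerC l m) -hornerN -hornerD -rootE rE.
  by rewrite rootZ // root_prod_XsubC.
elim: (r) rP => [|m r' IH] rP.
  by rewrite big_nil rmorph1; exists 1; rewrite mulr1.
rewrite big_cons rmorphM; apply: invertibleM.
  by rewrite rmorphB /= horner_algX horner_algC; apply: rP; rewrite mem_head.
by apply: IH => m' m'r; apply: rP; rewrite in_cons m'r orbT.
Qed.

(** The element [M^2 - p(a)^* p(a)] is [q(a)] for [q = M^2 - conj(p) p]; its spectrum
    consists of values of [q] on the spectrum of [a], and these are nonnegative. *)
Lemma horner_alg_norm p M : (forall l, sp l -> normc p.[l] <= M) ->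
  unorm (horner_alg a p) <= M.
Proof.
move=> pM; have M0 : 0 <= M.
  have [l spl] := aspectrum_nonempty a_sa.
  exact: le_trans (normc_ge0 _) (pM l spl).
rewrite -(ler_sqr (unorm_ge0 _)) ?nnegrE // -unorm_star.
apply: positive_le_norm; [exact: sqr_ge0|exact: positive_ustar_mul|].
pose q := ((M ^+ 2)%:C)%:P - map_poly conjc p * p.
have -> : scal B (M ^+ 2) - ustar (horner_alg a p) * horner_alg a p = horner_alg a q.
  by rewrite /q rmorphB (rmorphM (horner_alg a)) /= horner_algC horner_alg_star.
apply: positive_of_aspectrum.
  rewrite /self_adjoint horner_alg_star; congr (horner_alg a _).
  rewrite /q rmorphB (rmorphM (map_poly conjc)) /= map_polyC /= oppr0.
  have -> : map_poly conjc (map_poly conjc p) = p.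
    by apply/polyP => i; rewrite !coef_map /= conjcK.
  by rewrite mulrC.
move=> t /aspectrum_mapping[l spl].
rewrite /q hornerD hornerN hornerM hornerC horner_map_conjc // normcJ_mul -rmorphB.
move=> /complexI <-; rewrite subr_ge0 ler_sqr ?nnegrE ?normc_ge0 //; exact: pM.
Qed.

(** [c] is the value [h(a)] of the functional calculus: polynomials close to [h] on the
    spectrum have values close to [c].  A relation rather than a function, because its
    algebraic properties then hold without any continuity assumption on [h]. *)
Definition represents h c := forall r, 0 < r -> exists p,
  (forall l, sp l -> normc (p.[l] - h l) <= r) /\ unorm (horner_alg a p - c) <= r.

Lemma represents_poly p : represents (fun l => p.[l]) (horner_alg a p).
Proof.
move=> r r0; exists p; split=> [l _|]; first by rewrite subrr normc0 ltW.
by rewrite subrr unorm0 ltW.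
Qed.

Lemma represents_dist h k c d M : represents h c -> represents k d ->
  (forall l, sp l -> normc (h l - k l) <= M) -> unorm (c - d) <= M.
Proof.
move=> hc kd hk; apply/ler_addgt0Pl => r r0.
have r4 : 0 < r / 4 by rewrite divr_gt0 // ltr0n.
have [p [ph pc]] := hc _ r4; have [q [qk qd]] := kd _ r4.
have pq : unorm (horner_alg a (p - q)) <= M + r / 4 + r / 4.
  apply: horner_alg_norm => l spl; rewrite hornerD hornerN.
  have := normc_triangle (h l) p.[l] q.[l]; have := normc_triangle (k l) (h l) q.[l].
  by have := ph l spl; have := qk l spl; have := hk l spl; rewrite (normc_distC q.[l]); lra.
rewrite rmorphB /= in pq.
have := unorm_triangle (horner_alg a p) c d.
have := unorm_triangle (horner_alg a q) (horner_alg a p) d.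
by move: pq pc qd; rewrite (unorm_distC c (horner_alg a p)); lra.
Qed.

Lemma represents_uniq h c d : represents h c -> represents h d -> c = d.
Proof.
move=> hc hd; apply/eqP; rewrite -subr_eq0; apply/eqP/unorm_eq0/eqP.
rewrite eq_le unorm_ge0 andbT; apply: (represents_dist hc hd) => l _.
by rewrite subrr normc0.
Qed.

Lemma represents_norm h c M : represents h c ->
  (forall l, sp l -> normc (h l) <= M) -> unorm c <= M.
Proof.
move=> hc hM; rewrite -(subr0 c) -(rmorph0 (horner_alg a)).
apply: (represents_dist hc (represents_poly 0)) => l spl.
by rewrite horner0 subr0; exact: hM.
Qed.

Lemma represents_bounded h c : represents h c ->
  exists2 M, 0 < M & forall l, sp l -> normc (h l) <= M.
Proof.
move=> /(_ 1 ltr01)[p [ph _]]; have [M pM] := horner_normc_bounded p (unorm a).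
exists (`|M| + 1) => [|l spl]; first by rewrite ltr_wpDl.
have := normc_triangle p.[l] (h l) 0; rewrite !subr0 (normc_distC (h l)).
by have := ph l spl; have := pM l (aspectrum_normc spl); have := ler_norm M; lra.
Qed.

Lemma represents_closed h c :
  (forall r, 0 < r -> exists k d, [/\ represents k d,
     forall l, sp l -> normc (k l - h l) <= r & unorm (d - c) <= r]) ->
  represents h c.
Proof.
move=> lim r r0; have r2 : 0 < r / 2 by rewrite divr_gt0 // ltr0n.
have [k [d [kd kh dc]]] := lim _ r2; have [p [pk pd]] := kd _ r2.
exists p; split=> [l spl|].
  by have := normc_triangle (k l) p.[l] (h l); have := pk l spl; have := kh l spl; lra.
by have := unorm_triangle d (horner_alg a p) c; lra.
Qed.

Lemma represents_ext h k c : (forall l, sp l -> h l = k l) ->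
  represents h c -> represents k c.
Proof. by move=> hk hc r /hc[p [ph pc]]; exists p; split=> // l spl; rewrite -hk // ph. Qed.

Lemma representsD h k c d : represents h c -> represents k d ->
  represents (fun l => h l + k l) (c + d).
Proof.
move=> hc kd r r0; have r2 : 0 < r / 2 by rewrite divr_gt0 // ltr0n.
have [p [ph pc]] := hc _ r2; have [q [qk qd]] := kd _ r2.
exists (p + q); split=> [l spl|].
  rewrite hornerD opprD addrACA (le_trans (le_normcD _ _)) //.
  by have := ph l spl; have := qk l spl; lra.
by rewrite rmorphD opprD addrACA (le_trans (unormD _ _)) //; lra.
Qed.

Lemma representsM h k c d : represents h c -> represents k d ->
  represents (fun l => h l * k l) (c * d).
Proof.
move=> hc kd r r0; have [M1 M10 hM] := represents_bounded hc.
have [M2 M20 kM] := represents_bounded kd.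
pose M := M1 + M2 + unorm c + unorm d.
have [c0 d0] : 0 <= unorm c /\ 0 <= unorm d by rewrite !unorm_ge0.
have M0 : 0 < 2 * M + 1 by rewrite /M; lra.
pose s := Num.min 1 (r / (2 * M + 1)).
have s0 : 0 < s by rewrite lt_min ltr01 divr_gt0.
have s1 : s <= 1 by rewrite ge_min lexx.
have sr : (2 * M + 1) * s <= r.
  by rewrite mulrC -ler_pdivlMr // ge_min lexx orbT.
have [p [ph pc]] := hc _ s0; have [q [qk qd]] := kd _ s0.
exists (p * q); split=> [l spl|].
  have -> : (p * q).[l] - h l * k l =
    (p.[l] - h l) * (q.[l] - k l) + h l * (q.[l] - k l) + (p.[l] - h l) * k l.
    by rewrite hornerM; ring.
  rewrite (le_trans (le_normcD _ _)) // (le_trans (lerD (le_normcD _ _) (lexx _))) //.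
  rewrite !normcM.
  have := ph l spl; have := qk l spl; have := hM l spl; have := kM l spl.
  have := normc_ge0 (p.[l] - h l); have := normc_ge0 (q.[l] - k l).
  have := normc_ge0 (h l); have := normc_ge0 (k l).
  move: (normc (p.[l] - h l)) (normc (q.[l] - k l)) (normc (h l)) (normc (k l)) => u v w z.
  move=> z0 w0 v0 u0 zM wM vs us.
  have h1 : u * v <= s * s by rewrite ler_pM.
  have h2 : w * v <= M1 * s by rewrite ler_pM.
  have h3 : u * z <= s * M2 by rewrite ler_pM.
  have h4 : s * s <= s by rewrite ger_pMr.
  by have h5 := mulr_ge0 c0 (ltW s0); have h6 := mulr_ge0 d0 (ltW s0);
    have h7 := mulr_gt0 M10 s0; have h8 := mulr_gt0 M20 s0; move: sr; rewrite /M; lra.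
have -> : horner_alg a (p * q) - c * d = (horner_alg a p - c) * (horner_alg a q - d) +
    c * (horner_alg a q - d) + (horner_alg a p - c) * d.
  by rewrite rmorphM /= -mulrDl subrK mulrBr mulrBl addrA subrK.
rewrite (le_trans (unormD _ _)) // (le_trans (lerD (unormD _ _) (lexx _))) //.
have h1 := le_trans (unormM (horner_alg a p - c) (horner_alg a q - d))
   (ler_pM (unorm_ge0 _) (unorm_ge0 _) pc qd).
have h2 := le_trans (unormM c (horner_alg a q - d)) (ler_wpM2l c0 qd).
have h3 := le_trans (unormM (horner_alg a p - c) d) (ler_wpM2r d0 pc).
have h4 : s * s <= s by rewrite ger_pMr.
by have h7 := mulr_gt0 M10 s0; have h8 := mulr_gt0 M20 s0;
  have h5 := mulr_ge0 c0 (ltW s0); have h6 := mulr_ge0 d0 (ltW s0);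
  move: sr h1 h2 h3; rewrite /M; lra.
Qed.

Lemma representsZ l h c : represents h c ->
  represents (fun m => l * h m) (l *: c).
Proof.
move=> hc; have := representsM (represents_poly l%:P) hc.
rewrite horner_algC -scalerAl mul1r; apply: represents_ext => m _.
by rewrite hornerC.
Qed.

Lemma represents_star h c : represents h c -> represents (fun l => conjc (h l)) (ustar c).
Proof.
move=> hc r /hc[p [ph pc]]; exists (map_poly conjc p); split=> [l spl|].
  by rewrite horner_map_conjc // -rmorphB normc_conj ph.
by rewrite -horner_alg_star -ustarB ustar_norm.
Qed.

(** Apply the bound [horner_alg_norm] to the differences of a sequence of approximating
    polynomials: their values form a Cauchy sequence. *)
Lemma represents_exists h :
  (forall r, 0 < r -> exists p, forall l, sp l -> normc (p.[l] - h l) <= r) ->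
  exists c, represents h c.
Proof.
move=> happ.
have e0 n : 0 < (n.+1%:R^-1 : R) by rewrite invr_gt0 ltr0n.
have [p pP] := choice (fun n => happ _ (e0 n)).
have small r : 0 < r -> exists N, forall n, (N <= n)%N -> (n.+1%:R^-1 : R) <= r.
  move=> r0; have [N HN] : exists N : nat, r^-1 < N.+1%:R.
    exists (Num.bound r^-1); rewrite (lt_le_trans (archi_boundP _)) ?invr_ge0 ?(ltW r0) //.
    by rewrite ler_nat.
  exists N => n Nn; rewrite -[r]invrK lef_pV2 ?posrE ?invr_gt0 ?ltr0n //.
  by rewrite (le_trans (ltW HN)) // ler_nat.
have dist m n : unorm (horner_alg a (p m) - horner_alg a (p n)) <= m.+1%:R^-1 + n.+1%:R^-1.
  rewrite -rmorphB; apply: horner_alg_norm => l spl; rewrite hornerD hornerN.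
  have := normc_triangle (h l) (p m).[l] (p n).[l]; rewrite (normc_distC (h l)).
  by move/le_trans; apply; apply: lerD; exact: pP.
have [c lim] : exists c, forall r, 0 < r -> exists N, forall n, (N <= n)%N ->
    unorm (horner_alg a (p n) - c) <= r.
  apply: unorm_complete => r r0.
  have [N HN] := small _ (divr_gt0 r0 (ltr0n _ 2)).
  exists N => m n /HN hm /HN hn; by rewrite (le_trans (dist m n)) // (splitr r) lerD.
exists c => r r0; have [N1 H1] := small r r0; have [N2 H2] := lim r r0.
exists (p (maxn N1 N2)); split=> [l spl|]; last by apply: H2; rewrite leq_maxr.
by rewrite (le_trans (pP _ l spl)) // H1 // leq_maxl.
Qed.

End SelfAdjoint.
End Approximation.

(** * Weierstrass approximation on a compact set of reals *)

Section Weierstrass.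
Variable R : realType.
Implicit Types (K : set R) (h : R -> R) (p : {poly R}) (x y t s r e : R).

Definition continuous_onR K h := forall x, K x -> forall e, 0 < e ->
  exists2 d, 0 < d & forall y, K y -> `|y - x| < d -> `|h y - h x| <= e.

Lemma continuous_onR_bounded K h : compact K -> continuous_onR K h ->
  exists2 M, 0 <= M & forall x, K x -> `|h x| <= M.
Proof.
move=> /compact_near_coveringP/near_covering_withinP cov h_cont.
have [|N _ NP] := cov nat \oo (fun n x => `|h x| <= n%:R) _.
  move=> x Kx; have [d d0 dP] := h_cont x Kx 1 ltr01.
  exists (ball x d, [set n | (Num.bound (`|h x| + 1) <= n)%N]) => /=.
    by split; [exact: nbhsx_ballx|exact: nbhs_infty_ge].
  move=> [y n] /= [yd /= nN] Ky.
  have := dP y Ky; rewrite distrC => /(_ yd) hyx.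
  have : `|h x| + 1 < (Num.bound (`|h x| + 1))%:R by rewrite archi_boundP ?addr_ge0.
  have : (Num.bound (`|h x| + 1))%:R <= n%:R :> R by rewrite ler_nat.
  have := ler_normD (h y - h x) (h x); rewrite subrK.
  by move: hyx; lra.
by exists N%:R => // x Kx; apply: (NP N) => /=.
Qed.

(** Uniform continuity in the form needed by the second-moment method: oscillations
    beyond a distance [d] are absorbed by the quadratic term. *)
Lemma continuous_onR_quadratic K h : compact K -> continuous_onR K h ->
  forall e, 0 < e -> exists2 C, 0 <= C &
    forall x y, K x -> K y -> `|h y - h x| <= e + C * (y - x) ^+ 2.
Proof.
move=> K_compact h_cont e e0; have [M M0 hM] := continuous_onR_bounded K_compact h_cont.
move: K_compact => /compact_near_coveringP/near_covering_withinP cov.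
have [|N _ NP] := cov nat \oo
    (fun n x => forall y, K y -> `|h y - h x| <= e + n%:R * (y - x) ^+ 2) _.
  move=> x Kx; have [d d0 dP] := h_cont x Kx (e / 2) (divr_gt0 e0 (ltr0n _ 2)).
  pose C := 2 * M / (d / 2) ^+ 2; have d2 : 0 < d / 2 by rewrite divr_gt0 // ltr0n.
  exists (ball x (d / 2), [set n | (Num.bound C <= n)%N]) => /=.
    by split; [exact: nbhsx_ballx|exact: nbhs_infty_ge].
  move=> [z n] /= [zd /= nN] Kz y Ky.
  rewrite /ball /= distrC in zd.
  have dd : d / 2 < d by lra.
  have hzx := dP z Kz (lt_trans zd dd).
  have [yz|yz] := ltP `|y - z| (d / 2).
    have yx : `|y - x| < d by rewrite -(subrKA z) (le_lt_trans (ler_normD _ _)) //; lra.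
    have hyx := dP y Ky yx.
    have -> : h y - h z = (h y - h x) - (h z - h x) by ring.
    rewrite (le_trans (ler_normB _ _)) // (le_trans (lerD hyx hzx)) //.
    rewrite -splitr lerDl mulr_ge0 ?sqr_ge0 //.
  rewrite (le_trans (ler_normB _ _)) // (le_trans (lerD (hM y Ky) (hM z Kz))) //.
  have h1 : (d / 2) ^+ 2 <= (y - z) ^+ 2.
    by rewrite -[leRHS]real_normK ?num_real // ler_sqr ?nnegrE // ltW.
  have C0 : 0 <= C by apply: divr_ge0; [exact: mulr_ge0|exact: sqr_ge0].
  have h2 : C <= n%:R.
    by rewrite (le_trans (ltW (archi_boundP C0))) // ler_nat.
  have h3 : C * (d / 2) ^+ 2 <= n%:R * (y - z) ^+ 2.
    by rewrite ler_pM ?sqr_ge0.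
  have h4 : C * (d / 2) ^+ 2 = 2 * M by rewrite divfK // expf_neq0 // gt_eqF.
  by move: h3; rewrite h4; lra.
by exists N%:R => // x y Kx Ky; apply: (NP N) => /=.
Qed.

(** The expectation of [u (S_n)], where [S_n] counts the successes in [n] independent
    trials of probability ['X]; this is the Bernstein polynomial of [u].  The recursion
    conditions on one trial, which avoids binomial coefficients. *)
Fixpoint binomial_mean n (u : nat -> R) : {poly R} :=
  if n is n'.+1 then
    (1 - 'X) * binomial_mean n' u +
    'X * binomial_mean n' (fun j => u j.+1)
  else (u 0%N)%:P.

Lemma binomial_meanS n (u : nat -> R) t : (binomial_mean n.+1 u).[t] =
  (1 - t) * (binomial_mean n u).[t] +
  t * (binomial_mean n (fun j => u j.+1)).[t].
Proof. by rewrite /= !hornerE. Qed.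

(** The expectation is a positive functional at every [t] of [[0, 1]]. *)
Lemma binomial_mean_dist n (u v w : nat -> R) t : 0 <= t <= 1 ->
  (forall j, (j <= n)%N -> `|u j - v j| <= w j) ->
  `|(binomial_mean n u).[t] - (binomial_mean n v).[t]| <= (binomial_mean n w).[t].
Proof.
move=> /andP[t0 t1]; elim: n u v w => [|n IH] u v w uvw.
  by rewrite /= !hornerC uvw.
rewrite !binomial_meanS.
have h1 := IH u v w (fun j jn => uvw j (leqW jn)).
have h2 := IH _ _ _ (fun j jn => uvw j.+1 jn).
have -> : forall a b c d : R, (1 - t) * a + t * b - ((1 - t) * c + t * d) =
  (1 - t) * (a - c) + t * (b - d) by move=> *; ring.
rewrite (le_trans (ler_normD _ _)) // !normrM (ger0_norm t0) ger0_norm ?subr_ge0 //.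
by rewrite lerD // ler_wpM2l // subr_ge0.
Qed.

Lemma binomial_mean_cst n c t : (binomial_mean n (fun=> c)).[t] = c.
Proof. by elim: n => [|n IH]; rewrite ?binomial_meanS ?IH /= ?hornerC //; ring. Qed.

(** The variance of a binomial variable, around an arbitrary centre [c] since the
    induction shifts [c]. *)
Lemma binomial_mean_variance n a b c t :
  (binomial_mean n (fun j => a + b * (j%:R - c) ^+ 2)).[t] =
  a + b * (n%:R * t * (1 - t) + (n%:R * t - c) ^+ 2).
Proof.
elim: n c => [|n IH] c; first by rewrite /= hornerC; ring.
rewrite binomial_meanS IH.
have -> : (fun j => a + b * (j.+1%:R - c) ^+ 2) = fun j => a + b * (j%:R - (c - 1)) ^+ 2.
  by apply/funext => j; rewrite -natr1; ring.
by rewrite IH -natr1; ring.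
Qed.

(** Used to transport a function from [K] to the nodes of a Bernstein polynomial: the
    distance from [k] to a point [x] of [K] is at most [2 |x - y| + e]. *)
Lemma near_nearest_point K y e : K !=set0 -> 0 < e ->
  exists2 k, K k & forall x, K x -> `|k - y| <= `|x - y| + e.
Proof.
move=> [x0 Kx0] e0; pose D := [set `|x - y| | x in K].
have D_inf : has_inf D by split; [exists `|x0 - y|, x0|exists 0 => _ [x _ <-]].
have [_ [k Kk <-] kd] := inf_adherent e0 D_inf; exists k => // x Kx.
have : inf D <= `|x - y| by apply: (inf_lbound (proj2 D_inf)); exists x.
by move: kd; lra.
Qed.

(** Sample [h] at almost nearest points of [K] to the nodes [-L + 2 L j / n], and take
    the Bernstein polynomial of the sampled values.  At [x] in [K] the distance to [h x] is at
    most [e / 2] plus a multiple of the second moment, which is [O(1 / n)]. *)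
Theorem weierstrass_compact K h : compact K -> continuous_onR K h ->
  forall e, 0 < e -> exists p, forall x, K x -> `|p.[x] - h x| <= e.
Proof.
move=> K_compact h_cont e e0.
have [K0|K0] := pselect (K !=set0); last first.
  by exists 0 => x Kx; exfalso; apply: K0; exists x.
have e4 : 0 < e / 4 by rewrite divr_gt0 // ltr0n.
have [C C0 hC] := continuous_onR_quadratic K_compact h_cont e4.
have [L L0 KL] : exists2 L, 0 < L & forall x, K x -> `|x| <= L.
  have [M [_ MP]] := compact_bounded K_compact.
  exists (`|M| + 1) => [|x Kx]; first by rewrite ltr_wpDl.
  by apply: MP Kx; rewrite (le_lt_trans (ler_norm _)) // ltrDl.
pose eta := Num.min 1 (e / 4 / (2 * C + 1)).
have C1 : 0 < 2 * C + 1 by rewrite ltr_wpDl // mulr_ge0.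
have eta0 : 0 < eta by rewrite lt_min ltr01 divr_gt0.
have eta1 : eta <= 1 by rewrite ge_min lexx.
have etaC : (2 * C + 1) * eta <= e / 4.
  by rewrite mulrC -ler_pdivlMr // ge_min lexx orbT.
have [near nearK nearP] : exists2 near : R -> R, forall y, K (near y) &
    forall y x, K x -> `|near y - y| <= `|x - y| + eta.
  have [near nearP] := choice (fun y =>
    let: ex_intro2 k Kk kP := near_nearest_point y K0 eta0 in
    ex_intro (fun k => K k /\ forall x, K x -> `|k - y| <= `|x - y| + eta) k (conj Kk kP)).
  by exists near => y; case: (nearP y).
have hnear x y : K x -> `|h (near y) - h x| <= e / 2 + 8 * C * (y - x) ^+ 2.
  move=> Kx; apply: le_trans (hC x (near y) Kx (nearK y)) _.
  (* The point [near y] is at most [eta] farther from [y] than [x] is. *)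
  have d1 : `|near y - x| <= 2 * `|y - x| + eta.
    rewrite -(subrKA y) (le_trans (ler_normD _ _)) //.
    by have := nearP y x Kx; rewrite (distrC x); lra.
  have d2 : (near y - x) ^+ 2 <= (2 * `|y - x| + eta) ^+ 2.
    by rewrite -[leLHS]real_normK ?num_real // ler_sqr ?nnegrE // (le_trans _ d1).
  have d3 : (2 * `|y - x| + eta) ^+ 2 <= 8 * (y - x) ^+ 2 + 2 * eta.
    have -> : (y - x) ^+ 2 = `|y - x| ^+ 2 by rewrite real_normK ?num_real.
    by have := sqr_ge0 (2 * `|y - x| - eta); nra.
  have d4 := ler_wpM2l C0 (le_trans d2 d3).
  by move: d4 etaC; lra.
have e2 : 0 < e / 2 by rewrite divr_gt0 // ltr0n.
(* The second moment of the nodes around [x] is at most [4 L^2 / n]. *)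
pose bnd := 32 * C * L ^+ 2 / (e / 2); pose n := (Num.bound bnd).+1.
have n0 : 0 < n%:R :> R by rewrite ltr0n.
have nC : 32 * C * L ^+ 2 / n%:R <= e / 2.
  have bnd0 : 0 <= bnd.
    apply: divr_ge0 (ltW e2).
    by apply: mulr_ge0; [exact: mulr_ge0|exact: sqr_ge0].
  rewrite ler_pdivrMr // -(divfK (lt0r_neq0 e2) (32 * C * L ^+ 2)) -/bnd.
  rewrite mulrC ler_pM2l // (le_trans (ltW (archi_boundP bnd0))) //.
  by rewrite ler_nat.
pose node (j : nat) : R := 2 * L * j%:R / n%:R - L.
pose p := binomial_mean n (h \o near \o node) \Po (((2 * L)^-1)%:P * ('X + L%:P)).
exists p => x Kx; pose t := (2 * L)^-1 * (x + L).
have L2 : 0 < 2 * L by rewrite mulr_gt0 // ltr0n.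
have tx : 2 * L * t - L = x by rewrite mulrA mulfV ?gt_eqF // mul1r addrK.
have t01 : 0 <= t <= 1.
  have := KL x Kx; rewrite ler_norml => /andP[xL1 xL2].
  apply/andP; split; first by apply: mulr_ge0; [rewrite invr_ge0 ltW|lra].
  by rewrite /t mulrC ler_pdivrMr //; lra.
have -> : p.[x] = (binomial_mean n (h \o near \o node)).[t].
  by rewrite /p horner_comp !hornerE.
rewrite -(binomial_mean_cst n (h x) t).
pose b := 8 * C * (2 * L / n%:R) ^+ 2; pose c := n%:R * t.
have bP j : (j <= n)%N ->
    `|(h \o near \o node) j - h x| <= e / 2 + b * (j%:R - c) ^+ 2.
  move=> _; apply: le_trans (hnear x (node j) Kx) _; rewrite lerD2l.
  have -> : node j - x = 2 * L / n%:R * (j%:R - c).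
    rewrite -tx /node /c; field; exact: lt0r_neq0.
  by rewrite exprMn mulrA.
apply: le_trans (binomial_mean_dist t01 bP) _.
rewrite binomial_mean_variance subrr expr0n addr0.
suff : b * (n%:R * t * (1 - t)) <= e / 2 by lra.
apply: le_trans nC; have -> : b * (n%:R * t * (1 - t)) = 32 * C * L ^+ 2 / n%:R * (t * (1 - t)).
  by rewrite /b; field; exact: lt0r_neq0.
rewrite ler_piMr //; last by case/andP: t01; nra.
apply: divr_ge0 (ltW n0); apply: mulr_ge0; last exact: sqr_ge0.
exact: mulr_ge0.
Qed.

End Weierstrass.

(** * Norms and inner products in Hilbert modules *)

Section RealNorm.
Variables (R : realType) (V : normedModType R[i]).
Implicit Types x y z : V.

Lemma norm_rnorm x : `|x| = (rnorm x)%:C.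
Proof. by rewrite /rnorm RRe_real // ger0_real. Qed.

Lemma rnormD x y : rnorm (x + y) <= rnorm x + rnorm y.
Proof. by have := ler_normD x y; rewrite !norm_rnorm -rmorphD lecR. Qed.

Lemma rnormZ (k : R[i]) x : rnorm (k *: x) = normc k * rnorm x.
Proof.
by apply: (@complexI R); rewrite rmorphM /= -!norm_rnorm normrZ.
Qed.

Lemma rnorm_ge0 x : 0 <= rnorm x.
Proof. by have := normr_ge0 x; rewrite norm_rnorm ler0c. Qed.

Lemma rnorm0 : rnorm (0 : V) = 0.
Proof. by rewrite /rnorm normr0. Qed.

Lemma rnorm_eq0 x : rnorm x = 0 -> x = 0.
Proof. by move=> x0; apply/normr0_eq0; rewrite norm_rnorm x0. Qed.

Lemma rnorm_gt0 x : x <> 0 -> 0 < rnorm x.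
Proof.
by move=> x0; rewrite lt_neqAle rnorm_ge0 andbT eq_sym; apply/eqP => /rnorm_eq0.
Qed.

Lemma rnormN x : rnorm (- x) = rnorm x.
Proof. by rewrite /rnorm normrN. Qed.

Lemma rnormB x y : rnorm (x - y) <= rnorm x + rnorm y.
Proof. by rewrite -(rnormN y) rnormD. Qed.

Lemma rnorm_distC x y : rnorm (x - y) = rnorm (y - x).
Proof. by rewrite -rnormN opprB. Qed.

Lemma rnorm_triangle y x z : rnorm (x - z) <= rnorm (x - y) + rnorm (y - z).
Proof. by rewrite -[x - z](subrKA y) rnormD. Qed.

Lemma rnormZr (t : R) x : rnorm (t%:C *: x) = `|t| * rnorm x.
Proof. by rewrite rnormZ normc_real. Qed.

Lemma rnorm_small K x : (forall r, 0 < r -> rnorm x <= K * r) -> x = 0.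
Proof. by move=> small; apply/rnorm_eq0/(eq0_of_small (rnorm_ge0 x) small). Qed.

End RealNorm.

Lemma rnorm_complete (R : realType) (V : completeNormedModType R[i]) (u : nat -> V) :
  (forall e, 0 < e -> exists N, forall m n, (N <= m)%N -> (N <= n)%N ->
       rnorm (u m - u n) <= e) ->
  exists l, forall e, 0 < e -> exists N, forall n, (N <= n)%N -> rnorm (u n - l) <= e.
Proof.
move=> u_cauchy.
have cvg_u : cvg (u @ \oo).
  apply/cauchy_cvgP/cauchy_exP => e e0.
  have /andP[/eqP eI eR] : (complex.Im e == 0) && (0 < complex.Re e).
    by move: e0; rewrite ltcE /=.
  have [N NP] := u_cauchy _ (divr_gt0 eR (ltr0n _ 2)).
  exists (u N), N => // n /= Nn; rewrite -ball_normE /= norm_rnorm ltcE /= eI eqxx /=.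
  by rewrite (le_lt_trans (NP _ _ (leqnn N) Nn)) //; move: eR; lra.
exists (lim (u @ \oo)) => e e0.
have e0C : 0 < e%:C :> R[i] by rewrite ltcR.
have /cvgrPdist_lt/(_ _ e0C)[N _ NP] := cvg_u.
exists N => n Nn; have := NP n Nn; rewrite /= norm_rnorm ltcR rnorm_distC.
exact: ltW.
Qed.

Section HilbertModuleTheory.
Variables (R : realType) (A : cStarAlgType R).
Implicit Types (a b : A).

Lemma cmul_rnorm a b : rnorm (cmul a b) <= rnorm a * rnorm b.
Proof. by have := cnormM a b; rewrite !norm_rnorm -rmorphM lecR. Qed.

Lemma cstar_mul_rnorm a : rnorm (cmul (cstar a) a) = rnorm a ^+ 2.
Proof. by apply: (@complexI R); have := cnorm_star a; rewrite !norm_rnorm -rmorphXn. Qed.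

Lemma cstar_rnorm a : rnorm (cstar a) = rnorm a.
Proof.
have le b : rnorm b <= rnorm (cstar b).
  have [->|b0] := pselect (b = 0); first by rewrite rnorm0 rnorm_ge0.
  have := cmul_rnorm (cstar b) b; rewrite cstar_mul_rnorm expr2.
  by rewrite ler_pM2r // rnorm_gt0.
by apply/eqP; rewrite eq_le le andbT -{2}(cstarK a) le.
Qed.

Lemma cstar0 : cstar (0 : A) = 0.
Proof. by apply: (addrI (cstar 0)); rewrite -cstarD !addr0. Qed.

Lemma cstarN a : cstar (- a) = - cstar a.
Proof. by apply: (addrI (cstar a)); rewrite -cstarD !subrr cstar0. Qed.

Variable H : hilbertModType A.
Implicit Types x y z : H.

Lemma innerDl x y z : inner (x + y) z = inner x z + inner y z.
Proof. by rewrite innerC innerDr cstarD -!innerC. Qed.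

Lemma innerZl (k : R[i]) x y : inner (k *: x) y = conjc k *: inner x y.
Proof. by rewrite innerC innerZr cstarZ -innerC. Qed.

Lemma inner_actl x y a : inner (hact x a) y = cmul (cstar a) (inner x y).
Proof. by rewrite innerC inner_act cstarM -innerC. Qed.

Lemma inner0r x : inner x 0 = 0.
Proof. by apply: (addrI (inner x 0)); rewrite -innerDr !addr0. Qed.

Lemma inner0l x : inner 0 x = 0.
Proof. by rewrite innerC inner0r cstar0. Qed.

Lemma innerNr x y : inner x (- y) = - inner x y.
Proof. by rewrite -scaleN1r innerZr scaleN1r. Qed.

Lemma innerNl x y : inner (- x) y = - inner x y.
Proof. by rewrite innerC innerNr cstarN -innerC. Qed.

Lemma innerBr x y z : inner x (y - z) = inner x y - inner x z.
Proof. by rewrite innerDr innerNr. Qed.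

Lemma innerBl x y z : inner (x - y) z = inner x z - inner y z.
Proof. by rewrite innerDl innerNl. Qed.

Lemma inner_rnorm x : rnorm (inner x x) = rnorm x ^+ 2.
Proof. by apply: (@complexI R); have := hnorm_inner x; rewrite !norm_rnorm -rmorphXn. Qed.

Lemma inner_inj x y : (forall z, inner z x = inner z y) -> x = y.
Proof.
move=> xy; apply/eqP; rewrite -subr_eq0; apply/eqP/inner_eq0.
by rewrite innerBr xy subrr.
Qed.

End HilbertModuleTheory.

(** * Boundedness of adjointable operators *)

Section AdjointableTheory.
Variables (R : realType) (A : cStarAlgType R).
Implicit Types H K L : hilbertModType A.

Lemma adjointableD H K (T : adjointable H K) x y : T (x + y) = T x + T y.
Proof.
by apply: inner_inj => z; rewrite innerDr -!adjoint_subproof innerDr.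
Qed.

Lemma adjointableZ H K (T : adjointable H K) k x : T (k *: x) = k *: T x.
Proof.
by apply: inner_inj => z; rewrite innerZr -!adjoint_subproof innerZr.
Qed.

Lemma adjointable0 H K (T : adjointable H K) : T 0 = 0.
Proof. by rewrite -(scale0r (0 : H)) adjointableZ scale0r. Qed.

Lemma adjointableN H K (T : adjointable H K) x : T (- x) = - T x.
Proof. by rewrite -scaleN1r adjointableZ scaleN1r. Qed.

Lemma adjointableB H K (T : adjointable H K) x y : T (x - y) = T x - T y.
Proof. by rewrite adjointableD adjointableN. Qed.

(** The adjoint is determined by the operator, since an inner product separates points. *)
Lemma adjointable_ext H K (S T : adjointable H K) : S =1 T -> S = T.
Proof.
case: S T => [S S' SP] [T T' TP] /= /funext ST; rewrite -{}ST in TP *.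
have TS : T' = S'.
  by apply/funext => y; apply: inner_inj => x; rewrite -SP -TP.
by rewrite -{}TS in SP *; congr Adjointable; exact: Prop_irrelevance.
Qed.

Lemma adjoint_adjoint H K (T : adjointable H K) : adjoint (adjoint T) = T.
Proof. exact: adjointable_ext. Qed.

(** A hypothesis in the construction of operator algebras, which is carried out first for
    [A] itself: the order of that algebra enters the proof of the inequality in general. *)
Definition cauchy_schwarz H := forall x y : H, rnorm (inner x y) <= rnorm x * rnorm y.

(** Gliding hump.  If [T^*] is unbounded, choose [y n] in the unit ball such that
    [w n = T^* (y n)] is of norm at least [(n + 1) 3^n], and add successive vectors of
    norm [3^-n] along [w n], with signs such that the pairing of the [n]-th partial sum with [w n]
    is at least [3^-n ||w n||].  The remaining terms destroy at most half of this, so the limit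
    [x] satisfies [||<T x, y n>|| = ||<x, w n>|| >= (n + 1) / 2] for all [n]. *)
Lemma adjoint_bounded H K (T : adjointable H K) :
  cauchy_schwarz H -> cauchy_schwarz K ->
  exists2 M, 0 <= M & forall y, rnorm (adjoint T y) <= M * rnorm y.
Proof.
move=> csH csK; apply: contrapT => unbounded.
pose c n : R := 3^-1 ^+ n; have c0 n : 0 < c n by rewrite exprn_gt0 // invr_gt0 ltr0n.
have /choice[y yP] n : exists y : K, rnorm y <= 1 /\
    n.+1%:R / c n < rnorm (adjoint T y).
  apply: contrapT => /forallNP none; apply: unbounded; exists (n.+1%:R / c n).
    by rewrite divr_ge0 ?ler0n // ltW.
  move=> y; have [->|y0] := pselect (y = 0); first by rewrite adjointable0 !rnorm0 mulr0.
  have ny := rnorm_gt0 y0; rewrite leNgt; apply/negP => yT.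
  apply: (none ((rnorm y)^-1%:C *: y)); rewrite adjointableZ !rnormZr gtr0_norm ?invr_gt0 //.
  by split; [rewrite mulVf ?gt_eqF|rewrite [ltRHS]mulrC ltr_pdivlMr].
pose w n := adjoint T (y n).
have wn n : 0 < rnorm (w n).
  by apply: le_lt_trans (proj2 (yP n)); rewrite divr_ge0 ?ler0n // ltW.
pose v n : H := (c n / rnorm (w n))%:C *: w n.
have vn n : rnorm (v n) = c n.
  by rewrite rnormZr gtr0_norm ?divr_gt0 // divfK ?gt_eqF.
have vw n : rnorm (inner (v n) (w n)) = c n * rnorm (w n).
  rewrite innerZl conjc_real rnormZr inner_rnorm gtr0_norm ?divr_gt0 //.
  by rewrite expr2 mulrA divfK ?gt_eqF.
(* One of the two signs moves the pairing with [w n] away from zero. *)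
have [u uP] : exists u : nat -> H, forall n, rnorm (u n.+1 - u n) <= c n /\
    c n * rnorm (w n) <= rnorm (inner (u n.+1) (w n)).
  have step n (x : H) : exists x', rnorm (x' - x) <= c n /\
      c n * rnorm (w n) <= rnorm (inner x' (w n)).
    have : 2 * (c n * rnorm (w n)) <=
        rnorm (inner (x + v n) (w n)) + rnorm (inner (x - v n) (w n)).
      apply: le_trans (rnormB _ _); rewrite -innerBl opprB [X in inner X _]addrC.
      by rewrite addrA subrK -scale2r innerZl conjc_real rnormZr ger0_norm ?ler0n // vw.
    have [le1|lt1] := lerP (c n * rnorm (w n)) (rnorm (inner (x + v n) (w n))).
      by exists (x + v n); rewrite addrAC subrr add0r vn.
    exists (x - v n); rewrite addrAC subrr add0r rnormN vn; split=> //; lra.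
  have [f fP] := choice (fun nx : nat * H => step nx.1 nx.2).
  pose u := fix u n := if n is n'.+1 then f (n', u n') else 0.
  by exists u => n; exact: (fP (n, u n)).
pose s n : R := - (3 / 2) * c n.
have sS n : s n.+1 - s n = c n by rewrite /s /c exprS; field.
have s_step n : rnorm (u n.+1 - u n) <= s n.+1 - s n by rewrite sS; case: (uP n).
have s_le n : s n <= 0.
  by rewrite /s mulNr oppr_le0 mulr_ge0 ?divr_ge0 ?ler0n ?ltW.
have [x lim] := rnorm_complete
  (majorized_cauchy (rnorm0 _) (@rnormD _ _) (@rnormN _ _) s_step s_le).
(* The tail [3^-(n+1) + 3^-(n+2) + ...] is half of [3^-n]; [s] is the opposite of such tails. *)
have ux n : rnorm (u n.+1 - x) <= c n / 2.
  have sn : - s n.+1 = c n / 2 by rewrite /s /c exprS; field.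
  apply/ler_addgt0Pl => e /lim[N NP]; pose m := maxn N n.+1.
  have := rnorm_triangle (u m) (u n.+1) x; rewrite (rnorm_distC (u n.+1) (u m)).
  have := majorized_dist (rnorm0 _) (@rnormD _ _) s_step (leq_maxr N n.+1).
  by have := NP m (leq_maxl _ _); have := s_le m; rewrite -/m -sn; lra.
have big n : n.+1%:R / 2 <= rnorm (T x).
  have -> : n.+1%:R / 2 = n.+1%:R / c n * (c n / 2) by field; exact: lt0r_neq0.
  have h1 : rnorm (inner x (w n)) <= rnorm (T x).
    rewrite /w /= -adjointP (le_trans (csK _ _)) // ler_piMr ?rnorm_ge0 //.
    by case: (yP n).
  have := rnormD (inner x (w n)) (inner (u n.+1 - x) (w n)).
  rewrite -innerDl addrC subrK => h2.
  have h3 := le_trans (csH (u n.+1 - x) (w n)) (ler_wpM2r (ltW (wn n)) (ux n)).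
  have [_ h4] := uP n; have [_ /ltW/(ler_wpM2r (ltW (c0 n)))] := yP n; rewrite -/(w n).
  by move: h1 h2 h3 h4; lra.
have := big (Num.bound (2 * rnorm (T x))).
have : 2 * rnorm (T x) < (Num.bound (2 * rnorm (T x))).+1%:R.
  by rewrite (lt_le_trans (archi_boundP _)) ?mulr_ge0 ?rnorm_ge0 ?ler0n // ler_nat.
by lra.
Qed.

End AdjointableTheory.

(** * The C*-algebra of adjointable operators *)

Section OperatorNorm.
Variables (R : realType) (A : cStarAlgType R).
Implicit Types H K L : hilbertModType A.

Lemma opnorm_has_sup H K (T : adjointable H K) :
  cauchy_schwarz H -> cauchy_schwarz K ->
  has_sup [set rnorm (T x) | x in [set x : H | rnorm x <= 1]].
Proof.
move=> csH csK; split; first by exists (rnorm (T 0)), 0 => //=; rewrite rnorm0.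
have [M M0 MP] := adjoint_bounded (adjoint T) csK csH.
exists M => _ [x /= x1 <-]; apply: le_trans (MP x) _; exact: ler_piMr.
Qed.

Lemma opnormP H K (T : adjointable H K) x : cauchy_schwarz H -> cauchy_schwarz K ->
  rnorm (T x) <= opnorm T * rnorm x.
Proof.
move=> csH csK; have [->|x0] := pselect (x = 0).
  by rewrite adjointable0 !rnorm0 mulr0.
have nx := rnorm_gt0 x0; rewrite -ler_pdivrMr //.
apply: (sup_ubound (proj2 (opnorm_has_sup T csH csK))).
exists ((rnorm x)^-1%:C *: x); rewrite ?adjointableZ /= rnormZr gtr0_norm ?invr_gt0 //.
  by rewrite mulVf ?gt_eqF.
by rewrite mulrC.
Qed.

Lemma opnorm_le H K (T : adjointable H K) M : 0 <= M ->
  (forall x, rnorm (T x) <= M * rnorm x) -> opnorm T <= M.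
Proof.
move=> M0 MP; apply: sup_le_ub; first by exists (rnorm (T 0)), 0 => //=; rewrite rnorm0.
by move=> _ [x /= x1 <-]; apply: le_trans (MP x) _; exact: ler_piMr.
Qed.

Lemma opnorm_ge0 H K (T : adjointable H K) : cauchy_schwarz H -> cauchy_schwarz K ->
  0 <= opnorm T.
Proof.
move=> csH csK; apply: (sup_ubound (proj2 (opnorm_has_sup T csH csK))).
by exists 0; rewrite /= ?adjointable0 rnorm0 ?ler01.
Qed.

Lemma opnorm_adjoint_le H K (T : adjointable H K) : cauchy_schwarz H -> cauchy_schwarz K ->
  opnorm (adjoint T) <= opnorm T.
Proof.
move=> csH csK; apply: opnorm_le => [|y]; first exact: opnorm_ge0.
have [->|Ty] := pselect (adjoint T y = 0).
  by rewrite rnorm0 mulr_ge0 ?rnorm_ge0 ?opnorm_ge0.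
rewrite -(ler_pM2r (rnorm_gt0 Ty)) -expr2 -inner_rnorm adjoint_subproof.
rewrite (le_trans (csK _ _)) // mulrAC mulrC ler_wpM2r ?rnorm_ge0 //.
exact: opnormP.
Qed.

(** By the Cauchy-Schwarz inequality, since [||T x||^2 = ||<x, T^* T x>||]. *)
Lemma opnorm_star_mul H K (T : adjointable H K) : cauchy_schwarz H -> cauchy_schwarz K ->
  opnorm T ^+ 2 <= opnorm (adj_comp (adjoint T) T).
Proof.
move=> csH csK; set N := opnorm (adj_comp _ _).
have N0 : 0 <= N by exact: opnorm_ge0.
suff : opnorm T <= Num.sqrt N.
  by rewrite -(ler_sqr (opnorm_ge0 T csH csK)) ?nnegrE ?sqrtr_ge0 // sqr_sqrtr.
apply: opnorm_le => [|x]; first exact: sqrtr_ge0.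
rewrite -ler_sqr ?nnegrE ?mulr_ge0 ?sqrtr_ge0 ?rnorm_ge0 // exprMn sqr_sqrtr //.
rewrite -inner_rnorm adjointP (le_trans (csH _ _)) // expr2 mulrA mulrC.
rewrite ler_wpM2r ?rnorm_ge0 //; exact: (@opnormP _ _ (adj_comp (adjoint T) T)).
Qed.

End OperatorNorm.

(** The two proofs are arguments of the type because the algebra structure depends on
    them: the first makes the unit nonzero, the second gives the properties of the norm. *)
Definition opalg (R : realType) (A : cStarAlgType R) (H : hilbertModType A)
  (H_neq0 : exists x : H, x <> 0) (csH : cauchy_schwarz H) := adjointable H H.

Section OperatorAlgebra.
Variables (R : realType) (A : cStarAlgType R) (H : hilbertModType A).
Variables (H_neq0 : exists x : H, x <> 0) (csH : cauchy_schwarz H).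
Implicit Types S T U : adjointable H H.

Lemma op_add_subproof S T (x y : H) :
  inner (S x + T x) y = inner x (adjoint S y + adjoint T y).
Proof. by rewrite innerDl innerDr !adjointP. Qed.
Definition op_add S T : adjointable H H := Adjointable (op_add_subproof S T).

Lemma op_scale_subproof (k : R[i]) T (x y : H) :
  inner (k *: T x) y = inner x (conjc k *: adjoint T y).
Proof. by rewrite innerZl innerZr adjointP. Qed.
Definition op_scale k T : adjointable H H := Adjointable (op_scale_subproof k T).

Lemma op_id_subproof (x y : H) : inner (id x) y = inner x (id y).
Proof. by []. Qed.
Definition op_id : adjointable H H := Adjointable op_id_subproof.

Lemma op_zero_subproof (x y : H) : inner ((fun=> 0) x : H) y = inner x ((fun=> 0) y).
Proof. by rewrite inner0l inner0r. Qed.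
Definition op_zero : adjointable H H := Adjointable op_zero_subproof.

Local Notation B := (opalg H_neq0 csH).

HB.instance Definition _ := gen_eqMixin B.
HB.instance Definition _ := gen_choiceMixin B.

Lemma op_addA : associative (op_add : B -> B -> B).
Proof. by move=> S T U; apply: adjointable_ext => x /=; rewrite addrA. Qed.
Lemma op_addC : commutative (op_add : B -> B -> B).
Proof. by move=> S T; apply: adjointable_ext => x /=; rewrite addrC. Qed.
Lemma op_add0 : left_id (op_zero : B) op_add.
Proof. by move=> S; apply: adjointable_ext => x /=; rewrite add0r. Qed.
Lemma op_addN : left_inverse (op_zero : B) (op_scale (-1)) op_add.
Proof. by move=> S; apply: adjointable_ext => x /=; rewrite scaleN1r addNr. Qed.
HB.instance Definition _ := GRing.isZmodule.Build B op_addA op_addC op_add0 op_addN.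

Lemma op_mulA : associative (@adj_comp _ _ H H H : B -> B -> B).
Proof. by move=> S T U; apply: adjointable_ext. Qed.
Lemma op_mul1 : left_id (op_id : B) (@adj_comp _ _ H H H).
Proof. by move=> S; apply: adjointable_ext. Qed.
Lemma op_mulr1 : right_id (op_id : B) (@adj_comp _ _ H H H).
Proof. by move=> S; apply: adjointable_ext. Qed.
Lemma op_mulDl : left_distributive (@adj_comp _ _ H H H : B -> B -> B) +%R.
Proof. by move=> S T U; apply: adjointable_ext. Qed.
Lemma op_mulDr : right_distributive (@adj_comp _ _ H H H : B -> B -> B) +%R.
Proof. by move=> S T U; apply: adjointable_ext => x /=; rewrite adjointableD. Qed.
Lemma op_one_neq0 : (op_id : B) != 0.
Proof.
apply/eqP => id0; have [x x0] := H_neq0; apply: x0.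
by have := congr1 (fun T : adjointable H H => T x) id0.
Qed.
HB.instance Definition _ := GRing.Zmodule_isNzRing.Build B
  op_mulA op_mul1 op_mulr1 op_mulDl op_mulDr op_one_neq0.

Lemma op_scaleA (a b : R[i]) (T : B) : op_scale a (op_scale b T) = op_scale (a * b) T :> B.
Proof. by apply: adjointable_ext => x /=; rewrite scalerA. Qed.
Lemma op_scale1 : left_id (1 : R[i]) (op_scale : R[i] -> B -> B).
Proof. by move=> T; apply: adjointable_ext => x /=; rewrite scale1r. Qed.
Lemma op_scaleDr : right_distributive (op_scale : R[i] -> B -> B) +%R.
Proof. by move=> k S T; apply: adjointable_ext => x /=; rewrite scalerDr. Qed.
Lemma op_scaleDl (T : B) : {morph (op_scale^~ T : R[i] -> B) : a b / a + b}.
Proof. by move=> a b; apply: adjointable_ext => x /=; rewrite scalerDl. Qed.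
HB.instance Definition _ := GRing.Zmodule_isLmodule.Build R[i] B
  op_scaleA op_scale1 op_scaleDr op_scaleDl.

Lemma op_scaleAl (k : R[i]) (S T : B) : k *: (S * T) = k *: S * T.
Proof. by apply: adjointable_ext. Qed.
HB.instance Definition _ := GRing.Lmodule_isLalgebra.Build R[i] B op_scaleAl.
Lemma op_scaleAr (k : R[i]) (S T : B) : k *: (S * T) = S * (k *: T).
Proof. by apply: adjointable_ext => x /=; rewrite adjointableZ. Qed.
HB.instance Definition _ := GRing.Lalgebra_isAlgebra.Build R[i] B op_scaleAr.

Lemma op_normD (S T : B) : opnorm (S + T) <= opnorm S + opnorm T.
Proof.
apply: opnorm_le => [|x]; first by rewrite addr_ge0 ?opnorm_ge0.
by rewrite (le_trans (rnormD _ _)) // mulrDl lerD ?opnormP.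
Qed.
Lemma op_normZ_le (k : R[i]) (T : B) : opnorm (k *: T) <= normc k * opnorm T.
Proof.
apply: opnorm_le => [|x]; first by rewrite mulr_ge0 ?normc_ge0 ?opnorm_ge0.
by rewrite /= rnormZ -mulrA ler_wpM2l ?normc_ge0 ?opnormP.
Qed.
Lemma op_normZ (k : R[i]) (T : B) : opnorm (k *: T) = normc k * opnorm T.
Proof.
apply/eqP; rewrite eq_le op_normZ_le /=.
have [->|k0] := eqVneq k 0; first by rewrite normc0 mul0r opnorm_ge0.
have nk : 0 < normc k.
  by rewrite lt_neqAle normc_ge0 andbT eq_sym; apply: contra k0 => /eqP/eq0_normc ->.
have := op_normZ_le k^-1 (k *: T).
by rewrite scalerA mulVf // scale1r normcV mulrC ler_pdivlMr // mulrC.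
Qed.
Lemma op_normM (S T : B) : opnorm (S * T) <= opnorm S * opnorm T.
Proof.
apply: opnorm_le => [|x]; first by rewrite mulr_ge0 ?opnorm_ge0.
rewrite (le_trans (opnormP S (T x) csH csH)) // -mulrA ler_wpM2l ?opnorm_ge0 //.
exact: opnormP.
Qed.
Lemma op_norm_eq0 (T : B) : opnorm T = 0 -> T = 0.
Proof.
move=> T0; apply: adjointable_ext => x /=; apply: rnorm_eq0; apply/eqP.
by rewrite eq_le rnorm_ge0 andbT -(mul0r (rnorm x)) -T0 opnormP.
Qed.
Lemma op_starK (T : B) : adjoint (adjoint T) = T.
Proof. exact: adjointable_ext. Qed.
Lemma op_starD (S T : B) : adjoint (S + T : B) = (adjoint S : B) + (adjoint T : B).
Proof. exact: adjointable_ext. Qed.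
Lemma op_starZ (k : R[i]) (T : B) : adjoint (k *: T : B) = conjc k *: (adjoint T : B).
Proof. exact: adjointable_ext. Qed.
Lemma op_starM (S T : B) : adjoint (S * T : B) = (adjoint T : B) * (adjoint S : B).
Proof. exact: adjointable_ext. Qed.
Lemma op_norm_star (T : B) : opnorm T ^+ 2 <= opnorm ((adjoint T : B) * T).
Proof. exact: opnorm_star_mul. Qed.

(** A Cauchy sequence converges pointwise together with its adjoints, and the two
    pointwise limits are adjoint to each other. *)
Lemma op_complete (u : nat -> B) :
  (forall e, 0 < e -> exists N, forall m n, (N <= m)%N -> (N <= n)%N ->
       opnorm (u m - u n) <= e) ->
  exists l : B, forall e, 0 < e -> exists N, forall n, (N <= n)%N -> opnorm (u n - l) <= e.
Proof.
move=> u_cauchy.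
have pointwise (v : nat -> B) : (forall e, 0 < e -> exists N, forall m n,
    (N <= m)%N -> (N <= n)%N -> opnorm (v m - v n) <= e) ->
  forall x : H, exists l : H, forall e, 0 < e -> exists N, forall n, (N <= n)%N ->
    rnorm ((v n : adjointable H H) x - l) <= e.
  move=> v_cauchy x; apply: rnorm_complete => e e0.
  have x0 : 0 < rnorm x + 1 by rewrite ltr_wpDl ?rnorm_ge0.
  have [N NP] := v_cauchy _ (divr_gt0 e0 x0); exists N => m n Nm Nn.
  have := opnormP (v m - v n) x csH csH; rewrite /= scaleN1r => /le_trans; apply.
  rewrite (le_trans (ler_wpM2r (rnorm_ge0 x) (NP m n Nm Nn))) //.
  by rewrite -mulrA ger_pMr // mulrC ler_pdivrMr // mul1r lerDl.
have [f fP] := choice (pointwise u u_cauchy).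
have conjN1 : conjc (-1) = -1 :> R[i] by rewrite rmorphN rmorph1.
have star_cauchy e : 0 < e -> exists N, forall m n, (N <= m)%N -> (N <= n)%N ->
    opnorm ((adjoint (u m) : B) - (adjoint (u n) : B)) <= e.
  move=> /u_cauchy[N NP]; exists N => m n Nm Nn.
  apply: le_trans (NP m n Nm Nn); apply: le_trans (opnorm_adjoint_le _ csH csH).
  apply: opnorm_le => [|x]; first exact: opnorm_ge0.
  have -> : ((adjoint (u m) : B) - (adjoint (u n) : B) : B) = adjoint (u m - u n).
    apply: adjointable_ext => z /=; congr (_ + _ *: _).
    exact/esym/conjN1.
  exact: opnormP.
have [g gP] := choice (pointwise (fun n => adjoint (u n)) star_cauchy).
have fg (x y : H) : inner (f x) y = inner x (g y).
  apply/eqP; rewrite -subr_eq0; apply/eqP.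
  apply: (@rnorm_small _ _ (rnorm y + rnorm x)) => e e0.
  have [N1 H1] := fP x e e0; have [N2 H2] := gP y e e0; pose n := maxn N1 N2.
  have -> : inner (f x) y - inner x (g y) =
      inner x ((adjoint (u n)) y - g y) - inner ((u n : adjointable H H) x - f x) y.
    by rewrite innerBr innerBl adjointP opprB /= [RHS]addrC addrA subrK.
  rewrite (le_trans (rnormB _ _)) // addrC (mulrDl _ _ e) lerD //.
    by rewrite (le_trans (csH _ _)) // mulrC ler_wpM2l ?rnorm_ge0 ?H1 ?leq_maxl.
  by rewrite (le_trans (csH _ _)) // ler_wpM2l ?rnorm_ge0 ?H2 ?leq_maxr.
pose l : B := Adjointable fg; exists l => e e0.
have [N NP] := u_cauchy e e0; exists N => n Nn.
apply: opnorm_le => [|x]; first exact: ltW.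
rewrite /= scaleN1r; apply/ler_addgt0Pl => r /(fP x)[N' N'P].
pose m := maxn N N'.
have := rnorm_triangle ((u m : adjointable H H) x) ((u n : adjointable H H) x) (f x).
have := opnormP (u n - u m) x csH csH; rewrite /= scaleN1r.
have := ler_wpM2r (rnorm_ge0 x) (NP n m Nn (leq_maxl _ _)).
by have := N'P m (leq_maxr _ _); lra.
Qed.

HB.instance Definition _ := isUnitalCStar.Build R B
  op_normD op_normZ op_normM op_norm_eq0 op_starK op_starD op_starZ op_starM
  op_norm_star op_complete.

End OperatorAlgebra.

(** * The Cauchy-Schwarz inequality *)

(** [A] as a right module over itself. *)
Definition selfmod (R : realType) (A : cStarAlgType R) : Type := A.

Section SelfModule.
Variables (R : realType) (A : cStarAlgType R).
Local Notation M := (selfmod A).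

HB.instance Definition _ := CompleteNormedModule.copy M A.

Definition self_inner (a b : A) : A := cmul (cstar a) b.

Lemma self_actDl (x y : M) (a : A) :
  cmul (x + y : A) a = (cmul (x : A) a : M) + (cmul (y : A) a : M).
Proof. exact: cmulDl. Qed.
Lemma self_actDr (x : M) (a b : A) : cmul (x : A) (a + b) = (cmul (x : A) a : M) + cmul (x : A) b.
Proof. exact: cmulDr. Qed.
Lemma self_actM (x : M) (a b : A) : cmul (x : A) (cmul a b) = cmul (cmul (x : A) a) b.
Proof. exact: cmulA. Qed.
Lemma self_actZl (k : R[i]) (x : M) a : cmul (k *: x : A) a = k *: (cmul (x : A) a : M).
Proof. exact: cmulZl. Qed.
Lemma self_actZr (k : R[i]) (x : M) a : cmul (x : A) (k *: a) = k *: (cmul (x : A) a : M).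
Proof. exact: cmulZr. Qed.
Lemma self_innerDr (x y z : M) : self_inner x (y + z) = self_inner x y + self_inner x z.
Proof. exact: cmulDr. Qed.
Lemma self_innerZr (k : R[i]) (x y : M) : self_inner x (k *: y) = k *: self_inner x y.
Proof. exact: cmulZr. Qed.
Lemma self_inner_act (x y : M) a : self_inner x (cmul (y : A) a) = cmul (self_inner x y) a.
Proof. exact: cmulA. Qed.
Lemma self_innerC (x y : M) : self_inner y x = cstar (self_inner x y).
Proof. by rewrite /self_inner cstarM cstarK. Qed.
Lemma self_inner_ge0 (x : M) : cpositive (self_inner x x).
Proof. by exists x. Qed.
Lemma self_norm_inner (x : M) : `|self_inner x x| = `|x| ^+ 2.
Proof. exact: cnorm_star. Qed.
Lemma self_inner_eq0 (x : M) : self_inner x x = 0 -> x = 0.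
Proof.
move=> x0; apply/normr0_eq0/eqP; have := self_norm_inner x.
by rewrite x0 normr0 => /esym/eqP; rewrite sqrf_eq0.
Qed.

HB.instance Definition _ := isHilbertModule.Build R A M
  self_actDl self_actDr self_actM self_actZl self_actZr
  self_innerDr self_innerZr self_inner_act self_innerC self_inner_ge0
  self_inner_eq0 self_norm_inner.

Lemma self_cauchy_schwarz : cauchy_schwarz M.
Proof. by move=> a b; rewrite (le_trans (cmul_rnorm _ _)) // cstar_rnorm. Qed.

Hypothesis A_neq0 : exists a : M, a <> 0.
Local Notation B := (opalg A_neq0 self_cauchy_schwarz).

Lemma left_mul_subproof (a : A) (x y : M) :
  inner (cmul a (x : A) : M) y = inner x (cmul (cstar a) (y : A) : M).
Proof. by rewrite /inner /= /self_inner cstarM cmulA. Qed.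

(** The embedding of a possibly non-unital algebra into a unital one. *)
Definition left_mul (a : A) : B := Adjointable (left_mul_subproof a).

Lemma left_mulM a b : left_mul (cmul a b) = left_mul a * left_mul b.
Proof. by apply: adjointable_ext => x /=; rewrite -cmulA. Qed.

Lemma left_mulD a b : left_mul (a + b) = left_mul a + left_mul b.
Proof. by apply: adjointable_ext => x /=; rewrite cmulDl. Qed.

Lemma left_mulZ k a : left_mul (k *: a) = k *: left_mul a.
Proof. by apply: adjointable_ext => x /=; rewrite cmulZl. Qed.

Lemma left_mulN a : left_mul (- a) = - left_mul a.
Proof. by rewrite -scaleN1r left_mulZ scaleN1r. Qed.

Lemma left_mulB a b : left_mul (a - b) = left_mul a - left_mul b.
Proof. by rewrite left_mulD left_mulN. Qed.

Lemma left_mul_star a : left_mul (cstar a) = ustar (left_mul a).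
Proof. exact: adjointable_ext. Qed.

(** The value at [a^*] shows that the embedding is isometric. *)
Lemma left_mul_norm a : unorm (left_mul a) = rnorm a.
Proof.
apply/eqP; rewrite eq_le; apply/andP; split.
  apply: opnorm_le => [|x]; [exact: rnorm_ge0|exact: cmul_rnorm].
have [->|a0] := pselect (a = 0); first by rewrite rnorm0 unorm_ge0.
have sa0 : 0 < rnorm (cstar a) by rewrite cstar_rnorm rnorm_gt0.
have cs := self_cauchy_schwarz; rewrite -(ler_pM2r sa0).
have := opnormP (left_mul a) (cstar a : M) cs cs.
apply: le_trans; rewrite cstar_rnorm -expr2 -cstar_rnorm -cstar_mul_rnorm cstarK.
exact: lexx.
Qed.

Lemma positive_left_mul a : cpositive a -> positive (left_mul a).
Proof. by move=> [b ->]; rewrite left_mulM left_mul_star; exact: positive_ustar_mul. Qed.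

End SelfModule.

Section CauchySchwarz.
Variables (R : realType) (A : cStarAlgType R).
Implicit Types H K : hilbertModType A.

(** Put [a = <x, y>], [t = ||x||^2] and [z = x a - t y].  In the order of [A],
    [<x, x> <= t] gives [a^* <x, x> a <= t a^* a], and expanding [0 <= <z, z>] then gives
    [a^* a <= t <y, y>]; take norms. *)
Theorem inner_cauchy_schwarz H : cauchy_schwarz H.
Proof.
move=> x y; have [->|a0] := pselect (inner x y = 0).
  by rewrite rnorm0 mulr_ge0 ?rnorm_ge0.
set a := inner x y in a0 *; have A_neq0 : exists a : selfmod A, a <> 0 by exists a.
pose t := rnorm x ^+ 2.
have t0 : 0 <= t by exact: sqr_ge0.
pose c := inner x x; pose d := inner y y.
have c_sub : positive (scal _ t - left_mul A_neq0 c).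
  apply: positive_sub_of_norm; last by rewrite left_mul_norm inner_rnorm.
  exact/positive_sa/positive_left_mul/inner_ge0.
have d_sub : positive (scal _ (rnorm y ^+ 2) - left_mul A_neq0 d).
  apply: positive_sub_of_norm; last by rewrite left_mul_norm inner_rnorm.
  exact/positive_sa/positive_left_mul/inner_ge0.
pose aa := cmul (cstar a) a.
have zz : left_mul A_neq0 (inner (hact x a - t%:C *: y) (hact x a - t%:C *: y)) =
    ustar (left_mul A_neq0 a) * left_mul A_neq0 c * left_mul A_neq0 a -
    t%:C *: left_mul A_neq0 aa -
    (t%:C *: left_mul A_neq0 aa - t%:C *: (t%:C *: left_mul A_neq0 d)).
  rewrite innerBl !innerBr !innerZl !innerZr !inner_actl !inner_act conjc_real.
  rewrite [inner y x]innerC -/a -/c -/d -/aa !left_mulB !left_mulZ -left_mul_star -!left_mulM.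
  by rewrite !cmulA.
have pos1 := positive_left_mul A_neq0 (inner_ge0 (hact x a - t%:C *: y)).
rewrite zz in pos1.
(* [t a^* a - a^* <x, x> a] is positive. *)
have pos2 := positive_compress (left_mul A_neq0 a) c_sub.
rewrite mulrBr mulrBl scal_mulr -scalerAl -left_mul_star -left_mulM -/aa in pos2.
have := positiveD pos2 pos1.
rewrite -left_mul_star addrA subrKA subrr sub0r opprB -scalerBr => pos3.
have t_gt0 : 0 < t.
  rewrite exprn_gt0 // rnorm_gt0 // => x0; apply: a0; by rewrite /a x0 inner0l.
have tV0 : 0 <= t^-1 by rewrite invr_ge0.
have := positiveZ tV0 pos3.
rewrite scalerA -rmorphM mulVf ?gt_eqF // scale1r => pos4.
have := positiveD (positiveZ t0 d_sub) pos4.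
rewrite scalerBr addrA subrK /scal scalerA -rmorphM -/(scal _ _).
have aa_pos : positive (left_mul A_neq0 aa) by apply: positive_left_mul; exists a.
move=> /(positive_le_norm (mulr_ge0 t0 (sqr_ge0 _)) aa_pos).
by rewrite left_mul_norm cstar_mul_rnorm -exprMn ler_sqr ?nnegrE ?mulr_ge0 ?rnorm_ge0.
Qed.

End CauchySchwarz.

(** * Continuity on a set in metric form *)

Lemma within_continuous_distP (F : numFieldType) (S : set F) (h : F -> F) :
  {within S, continuous h} <->
  (forall x, S x -> forall e, 0 < e -> exists2 d, 0 < d &
     forall y, S y -> `|x - y| < d -> `|h x - h y| < e).
Proof.
split=> [/subspace_continuousP hc x Sx e e0|hc].
  have := hc x Sx => /cvgrPdist_lt/(_ _ e0).
  rewrite near_withinE => /nbhs_ballP[d /= d0 dP]; exists d => // y Sy xy.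
  by apply: dP => //; rewrite -ball_normE.
apply/subspace_continuousP => x Sx; apply/cvgrPdist_lt => e e0.
have [d d0 dP] := hc x Sx e e0; rewrite near_withinE; apply/nbhs_ballP.
by exists d => // y; rewrite -ball_normE => /= xy Sy; exact: dP.
Qed.

Lemma within_continuous_onR (R : realType) (S : set R) (h : R -> R) :
  {within S, continuous h} -> continuous_onR S h.
Proof.
move=> /within_continuous_distP hc x Sx e e0; have [d d0 dP] := hc x Sx e e0.
by exists d => // y Sy; rewrite distrC => xy; rewrite distrC ltW // dP.
Qed.

Section ComplexContinuity.
Variable R : realType.
Implicit Types (S : set (cplx R)) (h k : cplx R -> cplx R).

Lemma norm_normc (l : R[i]) : `|l| = (normc l)%:C.
Proof. by []. Qed.

Lemma within_continuous_normcP S h :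
  {within S, continuous h} <->
  (forall x, S x -> forall e : R, 0 < e -> exists2 d : R, 0 < d &
     forall y, S y -> normc (x - y : R[i]) < d -> normc (h x - h y : R[i]) < e).
Proof.
split=> [/within_continuous_distP hc x Sx e e0|hc].
  have e0C : 0 < (e%:C : cplx R) by rewrite ltcR.
  have [d d0 dP] := hc x Sx _ e0C.
  have /andP[/eqP dI dR] : (complex.Im d == 0) && (0 < complex.Re d).
    by move: d0; rewrite ltcE /=.
  exists (complex.Re d) => // y Sy xy; have := dP y Sy.
  rewrite !norm_normc ltcR; apply.
  by rewrite ltcE /= dI eqxx.
apply/within_continuous_distP => x Sx e e0.
have /andP[/eqP eI eR] : (complex.Im e == 0) && (0 < complex.Re e).
  by move: e0; rewrite ltcE /=.
have [d d0 dP] := hc x Sx _ eR; exists d%:C; first by rewrite ltcR.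
move=> y Sy; rewrite !norm_normc ltcR => /(dP y Sy) h1.
by rewrite ltcE /= eI eqxx.
Qed.

Lemma within_continuousM S h k : {within S, continuous h} -> {within S, continuous k} ->
  {within S, continuous (fun z => h z * k z)}.
Proof.
move=> hc kc x.
by apply: (@continuousM (cplx R) _ (h : subspace S -> _) (k : subspace S -> _));
  [exact: hc|exact: kc].
Qed.

Lemma within_continuousD S h k : {within S, continuous h} -> {within S, continuous k} ->
  {within S, continuous (fun z => h z + k z)}.
Proof.
move=> hc kc x.
by apply: (@continuousD (cplx R) (cplx R) _ (h : subspace S -> _) (k : subspace S -> _));
  [exact: hc|exact: kc].
Qed.

Lemma within_continuous_cst S (c : cplx R) :
  {within S, continuous (fun=> c : cplx R)}.
Proof. by apply: continuous_subspaceT; exact: cst_continuous. Qed.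

Lemma within_continuous_id S : {within S, continuous (id : cplx R -> cplx R)}.
Proof. by apply: continuous_subspaceT => z; exact: cvg_id. Qed.

Lemma horner_within_continuous S (p : {poly R[i]}) :
  {within S, continuous (fun z : cplx R => p.[z] : cplx R)}.
Proof.
elim/poly_ind: p => [|p c IH].
  have -> : (fun z : cplx R => (0 : {poly R[i]}).[z] : cplx R) = fun=> 0.
    by apply/funext => z; rewrite horner0.
  exact: within_continuous_cst.
have -> : (fun z : cplx R => (p * 'X + c%:P).[z] : cplx R) =
    (fun z => (p.[z] : cplx R) * z + c).
  by apply/funext => z; rewrite hornerMXaddC.
apply: within_continuousD; last exact: within_continuous_cst.
exact: (@within_continuousM S (fun z => p.[z]) id IH (@within_continuous_id S)).
Qed.

Lemma within_continuous_conj S h : {within S, continuous h} ->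
  {within S, continuous (fun z => conjc (h z) : cplx R)}.
Proof.
move=> /within_continuous_normcP hc; apply/within_continuous_normcP => x Sx e e0.
have [d d0 dP] := hc x Sx e e0; exists d => // y Sy xy.
by rewrite -rmorphB normc_conj dP.
Qed.

Lemma ler_norm_sqrtrB (s t : R) : 0 <= s -> 0 <= t ->
  `|Num.sqrt s - Num.sqrt t| <= Num.sqrt `|s - t|.
Proof.
wlog st : s t / t <= s => [wl s0 t0|s0 t0].
  have [ts|/ltW ts] := leP t s; first exact: wl.
  by rewrite distrC (distrC s) wl.
rewrite ger0_norm ?subr_ge0 ?ler_sqrt // ger0_norm ?subr_ge0 //.
rewrite lerBlDr -ler_sqr ?nnegrE ?addr_ge0 ?sqrtr_ge0 // sqrrD !sqr_sqrtr ?subr_ge0 //.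
have := mulr_ge0 (sqrtr_ge0 (s - t)) (sqrtr_ge0 t); lra.
Qed.

(** This is the function [k] with [|k|^2 + |h|^2 = M^2], which makes the value of
    [M^2 - |h|^2] under a *-homomorphism a positive element. *)
Lemma within_continuous_complement S h (M : R) :
  0 <= M -> (forall z, S z -> normc (h z : R[i]) <= M) -> {within S, continuous h} ->
  {within S, continuous (fun z =>
     (Num.sqrt (M ^+ 2 - normc (h z : R[i]) ^+ 2))%:C : cplx R)}.
Proof.
move=> M0 hM /within_continuous_normcP hc; apply/within_continuous_normcP => x Sx e e0.
have M1 : 0 < 2 * M + 1 by rewrite ltr_wpDl // mulr_ge0.
have [d d0 dP] := hc x Sx (e ^+ 2 / (2 * M + 1)) (divr_gt0 (exprn_gt0 2 e0) M1).
exists d => // y Sy xy; rewrite -rmorphB normc_real.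
have sub z : S z -> 0 <= M ^+ 2 - normc (h z : R[i]) ^+ 2.
  by move=> Sz; rewrite subr_ge0 ler_sqr ?nnegrE ?normc_ge0 // hM.
apply: le_lt_trans (ler_norm_sqrtrB (sub _ Sx) (sub _ Sy)) _.
have -> : e = Num.sqrt (e ^+ 2) by rewrite sqrtr_sqr gtr0_norm.
rewrite ltr_sqrt ?exprn_gt0 //.
have := dP y Sy xy; rewrite ltr_pdivlMr // => hxy.
have -> : M ^+ 2 - normc (h x : R[i]) ^+ 2 - (M ^+ 2 - normc (h y : R[i]) ^+ 2) =
  (normc (h y : R[i]) - normc (h x : R[i])) * (normc (h y : R[i]) + normc (h x : R[i])) by ring.
rewrite normrM.
have h1 : `|normc (h y : R[i]) - normc (h x : R[i])| <= normc (h x - h y : R[i]).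
  rewrite ler_norml.
  have := normc_triangle (h y : R[i]) (h x) 0; have := normc_triangle (h x : R[i]) (h y) 0.
  by rewrite !subr0 (normc_distC (h y)); lra.
have h2 : `|normc (h y : R[i]) + normc (h x : R[i])| <= 2 * M + 1.
  rewrite ger0_norm ?addr_ge0 ?normc_ge0 //.
  by have := hM x Sx; have := hM y Sy; lra.
exact: le_lt_trans (ler_pM _ _ h1 h2) hxy.
Qed.

End ComplexContinuity.

Lemma normcJ_mul_complement (R : realType) (u : R[i]) (M : R) : normc u <= M ->
  conjc u * u + conjc (Num.sqrt (M ^+ 2 - normc u ^+ 2))%:C *
    (Num.sqrt (M ^+ 2 - normc u ^+ 2))%:C = (M ^+ 2)%:C :> R[i].
Proof.
move=> uM; rewrite !normcJ_mul normc_real real_normK ?num_real //.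
have M0 : 0 <= M := le_trans (normc_ge0 u) uM.
rewrite sqr_sqrtr; last by rewrite subr_ge0 ler_sqr ?nnegrE ?normc_ge0.
by rewrite -rmorphD addrC subrK.
Qed.

(** The function on complex numbers to which [cfc] applies its homomorphism. *)
Definition realfun (R : realType) (phi : R -> R) : R[i] -> R[i] :=
  fun z => (phi (complex.Re z))%:C.

Lemma realfunE (R : realType) (phi : R -> R) t : realfun phi t%:C = (phi t)%:C.
Proof. by []. Qed.

(** * The continuous functional calculus of an operator *)

Section Calculus.
Variables (R : realType) (A : cStarAlgType R) (H : hilbertModType A).
Hypothesis H_neq0 : exists x : H, x <> 0.
Local Notation B := (opalg H_neq0 (@inner_cauchy_schwarz R A H)).
Implicit Types (a : B) (h k : cplx R -> cplx R).

Lemma spectrumP a (l : R[i]) : spectrum a l <-> aspectrum a l.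
Proof.
split=> spec [S SP]; apply: spec; exists S.
  case: SP => Sa aS x; split.
    by have := congr1 (fun T : adjointable H H => T x) Sa; rewrite /= scaleN1r.
  by have := congr1 (fun T : adjointable H H => T x) aS; rewrite /= scaleN1r.
by split; apply: adjointable_ext => x /=; rewrite scaleN1r; case: (SP x).
Qed.

Lemma spectrumE a : spectrum a = aspectrum a :> set R[i].
Proof. by apply/seteqP; split=> l /spectrumP. Qed.

Lemma real_spectrum_compact a : compact [set t : R | aspectrum a t%:C].
Proof.
apply: (subclosed_compact _ (@segment_compact _ (- unorm a) (unorm a))); last first.
  move=> t /= spec; rewrite in_itv /= aspectrum_le_norm // andbT lerNl -(unormN a).
  apply: aspectrum_le_norm => inv; apply: spec; apply: invertibleN.
  by move: inv; rewrite opprB rmorphN scaleNr opprK addrC.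
rewrite -openC openE => t /= /contrapT/invertible_open[d d0 dP].
apply/nbhs_ballP; exists d => //= u; rewrite /ball /= => tu.
apply: contrapT => /contrapT; apply.
have -> : a - u%:C *: 1 = a - t%:C *: 1 - scal _ (u - t).
  by rewrite scalB opprB addrA subrK.
by apply: dP; rewrite scal_norm distrC.
Qed.

(** The spectrum is a compact set of real numbers, so the real and the imaginary part of
    [h] are approximated separately by real polynomials. *)
Lemma continuous_approximable a h : self_adjoint a ->
  {within spectrum a, continuous h} ->
  forall r : R, 0 < r -> exists p : {poly R[i]},
    forall l, aspectrum a l -> normc (p.[l] - h l) <= r.
Proof.
move=> a_sa; rewrite spectrumE => /within_continuous_normcP hc r r0.
pose K := [set t : R | aspectrum a t%:C].
have part (re : R[i] -> R) : (forall z w : R[i], `|re z - re w| <= normc (z - w)) ->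
    continuous_onR K (fun t => re (h t%:C)).
  move=> reP x Kx e e0; have [d d0 dP] := hc x%:C Kx e e0; exists d => // y Ky xy.
  rewrite (le_trans (reP _ _)) // normc_distC ltW // dP //.
  by rewrite -rmorphB normc_real distrC.
have reP (z w : R[i]) : `|complex.Re z - complex.Re w| <= normc (z - w).
  case: z w => [z1 z2] [w1 w2] /=; rewrite -[leLHS]ger0_norm // -sqrtr_sqr.
  by rewrite ler_sqrt ?addr_ge0 ?sqr_ge0 // real_normK ?num_real // lerDl sqr_ge0.
have imP (z w : R[i]) : `|complex.Im z - complex.Im w| <= normc (z - w).
  case: z w => [z1 z2] [w1 w2] /=; rewrite -[leLHS]ger0_norm // -sqrtr_sqr.
  by rewrite ler_sqrt ?addr_ge0 ?sqr_ge0 // real_normK ?num_real // lerDr sqr_ge0.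
have r2 : 0 < r / 2 by rewrite divr_gt0 // ltr0n.
have K_compact : compact K := real_spectrum_compact (a := a).
have [p1 p1P] := weierstrass_compact K_compact (part _ reP) r2.
have [p2 p2P] := weierstrass_compact K_compact (part _ imP) r2.
exists (map_poly (real_complex R) p1 + 'i%:P * map_poly (real_complex R) p2) => l spl.
have lE := aspectrum_real a_sa spl; move: spl; rewrite lE; move: (complex.Re l) => t Kt.
rewrite hornerD hornerM hornerC !horner_map.
rewrite [h t%:C]complexE opprD addrACA -mulrBr -!rmorphB.
rewrite (le_trans (le_normcD _ _)) // normcM !normc_real.
have -> : normc 'i = 1 :> R by rewrite /= expr0n expr1n add0r sqrtr1.
by have := p1P t Kt; have := p2P t Kt; lra.
Qed.

(** The value is chosen by the relation [represents], which only depends on the restriction of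
    [h] to the spectrum; so does the value. *)
Definition calculus a h : B :=
  match pselect (exists c : B, represents a h c) with
  | left e => sval (cid e)
  | right _ => 0
  end.

Lemma calculusP a h : self_adjoint a -> {within spectrum a, continuous h} ->
  represents a h (calculus a h).
Proof.
move=> a_sa hc; rewrite /calculus; case: pselect => [e|]; first exact: (svalP (cid e)).
by case; apply: represents_exists => //; exact: continuous_approximable.
Qed.

Lemma calculusE a h c : self_adjoint a -> represents a h c -> calculus a h = c.
Proof.
move=> a_sa hc; rewrite /calculus; case: pselect => [e|]; last by case; exists c.
exact: (represents_uniq a_sa (svalP (cid e)) hc).
Qed.

Lemma calculus_hom a : self_adjoint a -> is_cfc_hom a (calculus a).
Proof.
move=> a_sa; split.
- move=> h k hk x; suff -> : calculus a h = calculus a k by [].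
  have E : represents a h = represents a k.
    have hk' l : aspectrum a l -> h l = k l.
      by move=> /spectrumP spl; apply: hk; rewrite inE.
    apply/funext => c; apply/propext; split; apply: represents_ext => // l /hk'.
    by move->.
  by rewrite /calculus E.
- suff -> : calculus a (fun=> 1) = op_id H by [].
  apply: calculusE => //; have := @represents_poly _ _ a 1.
  by rewrite rmorph1; apply: represents_ext => l _; rewrite hornerC.
- suff -> : calculus a id = a by [].
  apply: calculusE => //; have := @represents_poly _ _ a 'X.
  by rewrite horner_algX; apply: represents_ext => l _; rewrite hornerX.
- move=> h k hc kc x; have := representsD (calculusP a_sa hc) (calculusP a_sa kc).
  by move=> /(calculusE a_sa) ->.
- move=> c h hc x; have := representsZ a_sa c (calculusP a_sa hc).
  by move=> /(calculusE a_sa) ->.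
- move=> h k hc kc x; have := representsM a_sa (calculusP a_sa hc) (calculusP a_sa kc).
  by move=> /(calculusE a_sa) ->.
- move=> h hc x; have := represents_star a_sa (calculusP a_sa hc).
  by move=> /(calculusE a_sa) ->.
Qed.

Section AnyHom.
Variables (a : B) (Phi : (cplx R -> cplx R) -> adjointable H H).
Hypotheses (a_sa : self_adjoint a) (PhiP : is_cfc_hom a Phi).
Local Notation Psi := (Phi : (cplx R -> cplx R) -> B).

Lemma cfc_hom_cst (c : R[i]) : Psi (fun=> c) = c *: 1.
Proof.
apply: adjointable_ext => x /=; rewrite -[RHS]/(c *: x) -[X in _ = _ *: X](cfc_unit PhiP x).
rewrite -(cfcZ PhiP); last exact: within_continuous_cst.
by apply: (cfc_eq_on PhiP) => z _; rewrite mulr1.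
Qed.

Lemma cfc_hom_poly (p : {poly R[i]}) : Psi (fun z => p.[z]) = horner_alg a p.
Proof.
elim/poly_ind: p => [|p c IH].
  have -> : (fun z : cplx R => (0 : {poly R[i]}).[z]) = (fun=> 0).
    by apply/funext => z; rewrite horner0.
  by rewrite cfc_hom_cst scale0r rmorph0.
have -> : (fun z : cplx R => (p * 'X + c%:P).[z]) = (fun z => p.[z] * z + c).
  by apply/funext => z; rewrite hornerMXaddC.
rewrite rmorphD rmorphM /= horner_algX horner_algC -IH -cfc_hom_cst.
apply: adjointable_ext => x /=.
have id_cont := @within_continuous_id R (spectrum a).
have p_cont := @horner_within_continuous R (spectrum a) p.
have pM_cont := @within_continuousM R _ _ _ p_cont id_cont.
rewrite (cfcD PhiP pM_cont (@within_continuous_cst R (spectrum a) c)).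
by rewrite (cfcM PhiP p_cont id_cont) (cfc_id PhiP).
Qed.

(** *-homomorphisms are contractive: [M^2 - Phi(h)^* Phi(h)] is [Phi(k)^* Phi(k)]
    for the function [k] of [within_continuous_complement]. *)
Lemma cfc_hom_norm h (M : R) : {within spectrum a, continuous h} ->
  0 <= M -> (forall z, spectrum a z -> normc (h z : R[i]) <= M) -> unorm (Psi h) <= M.
Proof.
move=> hc M0 hM; have kc := within_continuous_complement M0 hM hc.
set k := (fun z => _) in kc.
rewrite -(ler_sqr (unorm_ge0 _)) ?nnegrE // -unorm_star.
apply: positive_le_norm; [exact: sqr_ge0|exact: positive_ustar_mul|].
have -> : scal B (M ^+ 2) - ustar (Psi h) * Psi h = ustar (Psi k) * Psi k.
  apply/eqP; rewrite subr_eq addrC; apply/eqP; rewrite /scal -cfc_hom_cst.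
  have conj_mul (g : cplx R -> cplx R) : {within spectrum a, continuous g} ->
      ustar (Psi g) * Psi g = Psi (fun z => conjc (g z) * g z).
    move=> gc; apply: adjointable_ext => x /=.
    by rewrite (cfcM PhiP (within_continuous_conj gc) gc) (cfc_star PhiP gc).
  rewrite !conj_mul //; apply: adjointable_ext => x /=.
  rewrite -(cfcD PhiP (within_continuousM (within_continuous_conj hc) hc)
    (within_continuousM (within_continuous_conj kc) kc)).
  apply: (cfc_eq_on PhiP) => z; rewrite inE => spz.
  exact: esym (normcJ_mul_complement (hM z spz)).
exact: positive_ustar_mul.
Qed.

(** Uniqueness of the functional calculus: [Phi] is determined on polynomials, and it is
    contractive. *)
Lemma cfc_hom_represents h : {within spectrum a, continuous h} -> represents a h (Psi h).
Proof.
move=> hc r r0; have [p ph] := continuous_approximable a_sa hc r0; exists p; split => //.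
have p_cont := @horner_within_continuous R (spectrum a) p.
have h_cont := within_continuousM (@within_continuous_cst R (spectrum a) (-1)) hc.
have ph_cont := within_continuousD p_cont h_cont.
have -> : horner_alg a p - Psi h = Psi (fun z => p.[z] + -1 * h z).
  rewrite -cfc_hom_poly; apply: adjointable_ext => x /=.
  by rewrite (cfcD PhiP p_cont h_cont) (cfcZ PhiP _ hc).
apply: cfc_hom_norm => //; first exact: ltW.
by move=> z /spectrumP spz; rewrite mulN1r; exact: ph.
Qed.

End AnyHom.

(** This identifies [cfc], which is defined from an arbitrary homomorphism, and shows that
    such a homomorphism exists. *)
Lemma cfc_represents a (phi : R -> R) : positive a ->
  continuous_onR `[0, +oo[ phi ->
  represents a (realfun phi) (cfc phi a : B).
Proof.
move=> a_pos phi_cont; have a_sa := positive_sa a_pos; rewrite /cfc.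
case: pselect => [e|]; last by case; exists (calculus a); exact: calculus_hom.
apply: (cfc_hom_represents a_sa (svalP (cid e))).
rewrite spectrumE; apply/within_continuous_normcP => x spx e0 e0_gt0.
have pos z : aspectrum a z -> z = (complex.Re z)%:C /\ (`[0, +oo[%classic : set R) (complex.Re z).
  move=> spz; have zE := aspectrum_real a_sa spz; split=> //=; rewrite in_itv /= andbT.
  by apply: (aspectrum_positive a_pos); rewrite -zE.
have [xE x0] := pos x spx.
have [d d0 dP] := phi_cont _ x0 (e0 / 2) (divr_gt0 e0_gt0 (ltr0n _ 2)).
exists d => // y spy; have [yE y0] := pos y spy.
rewrite {1}xE {1}yE -!rmorphB !normc_real => xy.
have := dP _ y0; rewrite distrC => /(_ xy); rewrite distrC; lra.
Qed.

End Calculus.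

(** * Continuity of powers and of cut-off inverses *)

Section RealFunctions.
Variable R : realType.
Implicit Types (phi h : R -> R) (s t u v e alpha : R) (p : {poly R}).
Local Notation pos := (`[0, +oo[%classic : set R).

Lemma posE t : pos t = (0 <= t).
Proof. by rewrite /= in_itv /= andbT. Qed.

Lemma continuous_onR_comp (K L : set R) phi h :
  (forall t, K t -> L (phi t)) -> continuous_onR K phi -> continuous_onR L h ->
  continuous_onR K (h \o phi).
Proof.
move=> KL phic hc x Kx e e0; have [d d0 dP] := hc _ (KL x Kx) e e0.
have [d' d'0 d'P] := phic x Kx (d / 2) (divr_gt0 d0 (ltr0n _ 2)).
exists d' => // y Ky xy; apply: dP; first exact: KL.
by have := d'P y Ky xy; lra.
Qed.

Lemma continuous_onR_sub (K L : set R) h : K `<=` L ->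
  continuous_onR L h -> continuous_onR K h.
Proof.
move=> KL hc x Kx e e0; have [d d0 dP] := hc x (KL x Kx) e e0.
by exists d => // y /KL; exact: dP.
Qed.

Lemma sqrt_continuous_onR : continuous_onR pos Num.sqrt.
Proof.
move=> x; rewrite posE => x0 e e0; exists (e ^+ 2); first by rewrite exprn_gt0.
move=> y; rewrite posE => y0 xy; apply: le_trans (ler_norm_sqrtrB y0 x0) _.
have -> : e = Num.sqrt (e ^+ 2) by rewrite sqrtr_sqr gtr0_norm.
by rewrite ler_sqrt ?ltW ?exprn_gt0.
Qed.

Lemma le_powR_unit t alpha : 0 <= t <= 1 -> alpha <= 1 -> t <= t `^ alpha.
Proof.
move=> /andP[t0 t1] a1; have [->|tn0] := eqVneq t 0; first exact: powR_ge0.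
by apply: ger1_powR => //; rewrite lt_neqAle eq_sym tn0 t0.
Qed.

(** Dividing by [u + v] reduces this to [t <= t^alpha] on [[0, 1]]. *)
Lemma powR_subadd u v alpha : 0 <= u -> 0 <= v -> 0 < alpha <= 1 ->
  (u + v) `^ alpha <= u `^ alpha + v `^ alpha.
Proof.
move=> u0 v0 /andP[a0 a1]; have [w0|wn0] := eqVneq (u + v) 0.
  by rewrite w0 powR0 ?gt_eqF // addr_ge0 ?powR_ge0.
have w0 : 0 < u + v by rewrite lt_neqAle eq_sym wn0 addr_ge0.
have unit t : 0 <= t -> t <= u + v -> t / (u + v) * (u + v) `^ alpha <= t `^ alpha.
  move=> t0 tw; have t01 : 0 <= t / (u + v) <= 1.
    by rewrite divr_ge0 ?(ltW w0) //= ler_pdivrMr // mul1r.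
  have {2}-> : t = t / (u + v) * (u + v) by rewrite divfK.
  case/andP: (t01) => t01' _; rewrite powRM ?(ltW w0) // ler_wpM2r ?powR_ge0 //.
  exact: le_powR_unit.
have := lerD (unit u u0 _) (unit v v0 _); rewrite lerDl lerDr => /(_ v0 u0).
by rewrite -mulrDl -mulrDl mulfV // mul1r.
Qed.

(** By subadditivity [|u^alpha - v^alpha| <= |u - v|^alpha], which also covers the
    endpoint [0]. *)
Lemma powR_continuous_onR alpha : 0 < alpha <= 1 ->
  continuous_onR pos (fun t => t `^ alpha).
Proof.
move=> a01; have [a0 a1] := andP a01.
have dist u v : 0 <= v -> v <= u -> `|u `^ alpha - v `^ alpha| <= (u - v) `^ alpha.
  move=> v0 vu; have u0 := le_trans v0 vu.
  have := @powR_subadd (u - v) v alpha; rewrite subrK subr_ge0 => /(_ vu v0 a01) h.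
  rewrite ger0_norm; first by rewrite lerBlDr.
  by rewrite subr_ge0 ge0_ler_powR ?nnegrE ?(ltW a0).
move=> x; rewrite posE => x0 e e0; exists (e `^ alpha^-1); first exact: powR_gt0.
move=> y; rewrite posE => y0 xy.
have le d : 0 <= d -> d < e `^ alpha^-1 -> d `^ alpha <= e.
  move=> d0 /ltW de; have -> : e = (e `^ alpha^-1) `^ alpha.
    by rewrite -powRrM mulVf ?gt_eqF // powRr1 // ltW.
  by rewrite ge0_ler_powR ?nnegrE ?powR_ge0 ?(ltW a0).
have [xley|/ltW ylex] := leP x y.
  apply: le_trans (dist y x x0 xley) (le _ _ _); first by rewrite subr_ge0.
  by rewrite ger0_norm ?subr_ge0 in xy.
rewrite distrC; apply: le_trans (dist x y y0 ylex) (le _ _ _); first by rewrite subr_ge0.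
by rewrite distrC ger0_norm ?subr_ge0 in xy.
Qed.

(** The inverse of [s] may be unbounded near [0]; it is frozen below [e]. *)
Lemma cutoff_inv_continuous_onR (s : R -> R) e : 0 < e ->
  (forall t, 0 < t -> 0 < s t) -> (forall t u, 0 <= t -> t <= u -> s t <= s u) ->
  continuous_onR pos s -> continuous_onR pos (fun t => (s (Num.max t e))^-1).
Proof.
move=> e0 s_gt0 s_nd sc.
have max_cont : continuous_onR pos (fun t => Num.max t e).
  move=> x _ r r0; exists r => // y _ xy; apply: le_trans (ltW xy).
  by rewrite !maxEle; case: (leP y e); case: (leP x e); rewrite !ler_norml; 
    move=> h1 h2; have := ler_norm (y - x); have := ler_norm (x - y); rewrite (distrC x);
    have := normr_ge0 (y - x); lra.
have smc := continuous_onR_comp (L := pos) _ max_cont sc.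
have inpos t : pos t -> pos (Num.max t e).
  by rewrite !posE => t0; rewrite le_max t0.
move=> x x0 r r0; have se := s_gt0 e e0.
have [d d0 dP] := smc inpos x x0 (r * s e ^+ 2) (mulr_gt0 r0 (exprn_gt0 2 se)).
exists d => // y y0 xy; have := dP y y0 xy; rewrite /=.
have ge t : s e <= s (Num.max t e) by apply: s_nd; rewrite ?(ltW e0) // le_max lexx orbT.
have := ge x; have := ge y; move: (s (Num.max x e)) (s (Num.max y e)) => u v ev eu uv.
have u0 := lt_le_trans se eu; have v0 := lt_le_trans se ev.
have -> : v^-1 - u^-1 = (u - v) / (u * v).
  by field; rewrite !gt_eqF.
rewrite normrM distrC normfV (gtr0_norm (mulr_gt0 u0 v0)) ler_pdivrMr ?mulr_gt0 //.
apply: le_trans uv _; by rewrite ler_pM2l // expr2 ler_pM // ?(ltW se).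
Qed.

End RealFunctions.

(** * Composition in the functional calculus *)

Section RealCalculus.
Variables (R : realType) (B : unitalCStarType R) (a : B).
Hypothesis a_pos : positive a.
Implicit Types (c d : B) (phi psi h : R -> R) (t r M : R).
Local Notation pos := (`[0, +oo[%classic : set R).

Let a_sa : self_adjoint a := positive_sa a_pos.

Lemma aspectrum_itv l : aspectrum a l ->
  exists2 t, l = t%:C & 0 <= t <= unorm a.
Proof.
move=> spl; have lE := aspectrum_real a_sa spl; exists (complex.Re l) => //.
by rewrite lE in spl; rewrite (aspectrum_positive a_pos spl) (aspectrum_le_norm spl).
Qed.

Lemma realfun_sa phi c : represents a (realfun phi) c -> self_adjoint c.
Proof.
move=> hc; have hc' : represents a (realfun phi) (ustar c).
  by apply: represents_ext (represents_star a_sa hc) => l _; exact: conjc_real.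
exact: represents_uniq hc' hc.
Qed.

Lemma realfun_norm phi c M : represents a (realfun phi) c ->
  (forall t, 0 <= t <= unorm a -> `|phi t| <= M) -> unorm c <= M.
Proof.
move=> hc hM; apply: (represents_norm a_sa hc) => l /aspectrum_itv[t -> t01].
by rewrite realfunE normc_real hM.
Qed.

Lemma realfun_positive phi c : represents a (realfun phi) c ->
  (forall t, 0 <= t -> 0 <= phi t) -> positive c.
Proof.
move=> hc phi0; have [M M0 hM] := represents_bounded a_sa hc.
apply: (@positive_of_norm_sub _ _ _ M); first exact: realfun_sa hc.
have := representsD (represents_poly a (M%:C)%:P) (representsZ a_sa (-1) hc).
rewrite horner_algC scaleN1r => hMc.
apply: (represents_norm a_sa hMc) => l spl; have := hM l spl.
have [t -> /andP[t0 _]] := aspectrum_itv spl.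
rewrite realfunE hornerC mulN1r -rmorphB !normc_real ger0_norm ?phi0 // => tM.
by rewrite ger0_norm ?subr_ge0 // gerBl phi0.
Qed.

Lemma realfunM phi psi c d : represents a (realfun phi) c -> represents a (realfun psi) d ->
  represents a (realfun (fun t => phi t * psi t)) (c * d).
Proof.
move=> hc hd; apply: represents_ext (representsM a_sa hc hd) => l _.
by rewrite /realfun rmorphM.
Qed.

Lemma represents_horner k c (p : {poly R[i]}) : represents a k c ->
  represents a (fun l => p.[k l]) (horner_alg c p).
Proof.
move=> kc; elim/poly_ind: p => [|p m IH].
  rewrite rmorph0; have := represents_poly a 0; rewrite rmorph0.
  by apply: represents_ext => l _; rewrite !horner0.
rewrite rmorphD rmorphM /= horner_algX horner_algC.
have := representsD (representsM a_sa IH kc) (represents_poly a m%:P).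
rewrite horner_algC; apply: represents_ext => l _.
by rewrite hornerMXaddC hornerC.
Qed.

Lemma realfun_near_poly phi c (p : {poly R}) L r : unorm a <= L ->
  (forall t, 0 <= t <= L -> `|p.[t] - phi t| <= r) ->
  represents a (realfun phi) c ->
  unorm (horner_alg a (map_poly (real_complex R) p) - c) <= r.
Proof.
move=> aL pP hc; apply: (represents_dist a_sa (represents_poly a _) hc) => l.
move=> /aspectrum_itv[t -> /andP[t0 ta]].
by rewrite realfunE horner_map -rmorphB normc_real pP // t0 (le_trans ta).
Qed.

End RealCalculus.

Lemma weierstrass_itv (R : realType) (phi : R -> R) (L : R) :
  continuous_onR `[0, +oo[%classic phi -> forall r, 0 < r ->
  exists p : {poly R}, forall t, 0 <= t <= L -> `|p.[t] - phi t| <= r.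
Proof.
move=> phic r r0.
have phic' : continuous_onR [set` `[0, L]] phi.
  by apply: continuous_onR_sub phic => t /=; rewrite !in_itv /= andbT => /andP[].
have [p pP] := weierstrass_compact (@segment_compact R 0 L) phic' r0.
by exists p => t t01; apply: pP; rewrite /= in_itv.
Qed.

Section Composition.
Variables (R : realType) (A : cStarAlgType R) (H : hilbertModType A).
Hypothesis H_neq0 : exists x : H, x <> 0.
Local Notation B := (opalg H_neq0 (@inner_cauchy_schwarz R A H)).
Local Notation pos := (`[0, +oo[%classic : set R).

(** Polynomials close to [h] on an interval containing the spectrum of [b] and the
    values of [phi] give elements close to [h(b)] and functions close to [h o phi]. *)
Lemma cfc_comp (a b : B) (phi h : R -> R) : positive a ->
  represents a (realfun phi) b -> (forall t, 0 <= t -> 0 <= phi t) ->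
  continuous_onR pos h -> represents a (realfun (h \o phi)) (cfc h b : B).
Proof.
move=> a_pos ab phi0 hc; have a_sa := positive_sa a_pos.
have b_pos := realfun_positive a_pos ab phi0.
have hb := cfc_represents b_pos hc.
have [M M0 phiM] := represents_bounded a_sa ab.
apply: represents_closed => r r0.
have [p pP] := weierstrass_itv (unorm b + M) hc r0.
exists (fun l => (map_poly (real_complex R) p).[realfun phi l]).
exists (horner_alg b (map_poly (real_complex R) p)); split.
- exact: represents_horner ab.
- move=> l spl; have := phiM l spl; have [t -> /andP[t0 _]] := aspectrum_itv a_pos spl.
  rewrite realfunE horner_map -rmorphB !normc_real ger0_norm ?phi0 // => tM.
  by rewrite pP // phi0 // (le_trans tM) // lerDr unorm_ge0.
- by apply: (realfun_near_poly b_pos _ pP hb); rewrite lerDl ltW.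
Qed.

End Composition.

(** * An operator between two modules *)

(** Positivity in [A] is positivity of left multiplications. *)
Lemma cpositive_anti (R : realType) (A : cStarAlgType R) (b : A) :
  cpositive b -> cpositive (- b) -> b = 0.
Proof.
move=> b_pos nb_pos; have [//|b0] := pselect (b = 0).
have A_neq0 : exists a : selfmod A, a <> 0 by exists b.
have := positive_left_mul A_neq0 nb_pos; rewrite left_mulN.
move=> /(positive_anti (positive_left_mul A_neq0 b_pos)) lb0.
by apply: rnorm_eq0; rewrite -(left_mul_norm A_neq0) lb0 unorm0.
Qed.

Section TwoModules.
Variables (R : realType) (A : cStarAlgType R) (H K : hilbertModType A).
Hypotheses (H_neq0 : exists x : H, x <> 0) (K_neq0 : exists y : K, y <> 0).
Variable T : adjointable H K.
Local Notation BH := (opalg H_neq0 (@inner_cauchy_schwarz R A H)).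
Local Notation BK := (opalg K_neq0 (@inner_cauchy_schwarz R A K)).
Local Notation pos := (`[0, +oo[%classic : set R).
Let a : BH := adj_comp (adjoint T) T.
Let b : BK := adj_comp T (adjoint T).

(** If [k T^* T k = - z^2] then [<T k x, T k x> = - <z x, z x>], and both inner
    products are positive in [A]. *)
Lemma positive_adjoint_mul : positive a.
Proof.
apply: positive_of_no_negative_compression.
  by apply: adjointable_ext.
move=> k z k_sa z_sa kz; apply: adjointable_ext => x /=; apply: inner_eq0.
have op x' : (k * a * k : adjointable H H) x' = - ((z * z : adjointable H H) x').
  by rewrite kz /= scaleN1r.
have adj (S : BH) (S_sa : self_adjoint S) u v :
    inner ((S : adjointable H H) u) v = inner u ((S : adjointable H H) v).
  by rewrite adjointP -{2}S_sa.
have E : inner (T ((k : adjointable H H) x)) (T ((k : adjointable H H) x)) =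
    - inner ((z : adjointable H H) x) ((z : adjointable H H) x).
  rewrite adjointP adj // [in RHS]adj // -innerNr; congr inner.
  exact: op.
apply: cpositive_anti; first exact: inner_ge0.
by rewrite -E; exact: inner_ge0.
Qed.

Lemma opnorm_adjoint_mul_le : opnorm (a : adjointable H H) <= opnorm T ^+ 2.
Proof.
have csH := @inner_cauchy_schwarz R A H; have csK := @inner_cauchy_schwarz R A K.
have N0 := opnorm_ge0 T csH csK.
apply: opnorm_le => [|x]; first exact: sqr_ge0.
rewrite /= (le_trans (opnormP (adjoint T) (T x) csK csH)) // expr2 -mulrA.
rewrite ler_pM ?opnorm_ge0 ?rnorm_ge0 //; first exact: opnorm_adjoint_le.
exact: opnormP.
Qed.

Lemma horner_intertwine (p : {poly R[i]}) x :
  T ((horner_alg a p : adjointable H H) x) = (horner_alg b p : adjointable K K) (T x).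
Proof.
elim/poly_ind: p x => [|p c IH] x.
  by rewrite !rmorph0 /= adjointable0.
rewrite !rmorphD !rmorphM /= !horner_algX !horner_algC /=.
by rewrite adjointableD adjointableZ IH.
Qed.

(** This holds for polynomials; a polynomial that is close to [phi] on an interval containing both
    spectra is used for [a] and [b] at the same time. *)
Lemma calculus_intertwine phi (c : BH) (d : BK) x : positive b -> continuous_onR pos phi ->
  represents a (realfun phi) c -> represents b (realfun phi) d ->
  T ((c : adjointable H H) x) = (d : adjointable K K) (T x).
Proof.
move=> b_pos phic ac bd; apply/eqP; rewrite -subr_eq0; apply/eqP.
have csH := @inner_cauchy_schwarz R A H; have csK := @inner_cauchy_schwarz R A K.
apply: (@rnorm_small _ _ (opnorm T * rnorm x + rnorm (T x))) => r r0.
have [p pP] := weierstrass_itv (unorm a + unorm b) phic r0.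
have aL : unorm a <= unorm a + unorm b by rewrite lerDl unorm_ge0.
have bL : unorm b <= unorm a + unorm b by rewrite lerDr unorm_ge0.
have ca := realfun_near_poly positive_adjoint_mul aL pP ac.
have db := realfun_near_poly b_pos bL pP bd.
set q := map_poly _ p in ca db.
have -> : T ((c : adjointable H H) x) - (d : adjointable K K) (T x) =
  ((horner_alg b q - d : BK) : adjointable K K) (T x) -
  T (((horner_alg a q - c : BH) : adjointable H H) x).
  by rewrite /= !scaleN1r adjointableB horner_intertwine opprB [RHS]addrC addrA subrK.
rewrite (le_trans (rnormB _ _)) // addrC mulrDl lerD //.
  rewrite (le_trans (opnormP T _ csH csK)) // -mulrA ler_wpM2l ?opnorm_ge0 //.
  by rewrite mulrC (le_trans (opnormP _ _ csH csH)) // ler_wpM2r ?rnorm_ge0.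
by rewrite mulrC (le_trans (opnormP _ _ csK csK)) // ler_wpM2r ?rnorm_ge0.
Qed.

(** [||T c x||^2 = ||<x, c a c x>||], and [c a c] is the value of [t phi(t)^2]. *)
Lemma calculus_bound phi (c : BH) M x : 0 <= M -> represents a (realfun phi) c ->
  (forall t, 0 <= t <= opnorm T ^+ 2 -> t * phi t ^+ 2 <= M ^+ 2) ->
  rnorm (T ((c : adjointable H H) x)) <= M * rnorm x.
Proof.
move=> M0 ac phiM; have csH := @inner_cauchy_schwarz R A H.
have c_sa := realfun_sa positive_adjoint_mul ac.
have aa : represents a (realfun (fun t => t)) a.
  have := represents_poly a 'X; rewrite horner_algX; apply: represents_ext => l spl.
  by rewrite hornerX /realfun -(aspectrum_real (positive_sa positive_adjoint_mul) spl).
have cac := realfunM positive_adjoint_mul ac (realfunM positive_adjoint_mul aa ac).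
have normcac : unorm (c * (a * c)) <= M ^+ 2.
  apply: (realfun_norm positive_adjoint_mul cac) => t /andP[t0 ta].
  have -> : phi t * (t * phi t) = t * phi t ^+ 2 by ring.
  rewrite ger0_norm; last by apply: mulr_ge0 => //; exact: sqr_ge0.
  by apply: phiM; rewrite t0 (le_trans ta) //; exact: opnorm_adjoint_mul_le.
rewrite -ler_sqr ?nnegrE ?mulr_ge0 ?rnorm_ge0 // -inner_rnorm adjointP adjointP.
have -> : adj_cofun (c : adjointable H H) (adj_cofun T (T ((c : adjointable H H) x))) =
   ((c * (a * c) : BH) : adjointable H H) x.
  exact: (congr1 (fun S : adjointable H H => S _) c_sa).
rewrite (le_trans (csH _ _)) // exprMn.
apply: le_trans (ler_wpM2l (rnorm_ge0 x) (opnormP _ x csH csH)) _.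
by rewrite mulrCA -expr2 ler_wpM2r ?sqr_ge0.
Qed.

End TwoModules.

Local Close Scope complex_scope.
Unset Implicit Arguments.

(** * The mixed Cauchy-Schwarz inequality *)

Theorem theorem3p1 (R : realType) (A : cStarAlgType R) (H K : hilbertModType A)
  (H_neq0 : exists x : H, x <> 0) (K_neq0 : exists y : K, y <> 0)
  (f g : R -> R)
  (f_ge0 : forall t : R, 0 <= t -> 0 <= f t)
  (g_ge0 : forall t : R, 0 <= t -> 0 <= g t)
  (f_cont : {within `[0, +oo[, continuous f})
  (g_cont : {within `[0, +oo[, continuous g})
  (fgE : forall t : R, 0 <= t -> f t * g t = t)
  (T : adjointable H K) (T_neq0 : (T : H -> K) <> (fun _ : H => 0))
  (alpha : R) (alpha_gt0 : 0 < alpha) (alpha_le1 : alpha <= 1)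
  (x : H) (y : K) :
  rnorm (inner (T x) y) <=
    opnorm T `^ (1 - alpha) *
    rnorm (cfc f (powop (absop T) alpha) x) *
    rnorm (cfc g (powop (absop (adjoint T)) alpha) y).
Proof.
pose csH := @inner_cauchy_schwarz R A H; pose csK := @inner_cauchy_schwarz R A K.
pose BH := opalg H_neq0 csH; pose BK := opalg K_neq0 csK.
have a01 : 0 < alpha <= 1 by rewrite alpha_gt0.
have fc := within_continuous_onR f_cont; have gc := within_continuous_onR g_cont.
have rootc := @sqrt_continuous_onR R; have powc := powR_continuous_onR a01.
pose a : BH := adj_comp (adjoint T) T; pose b : BK := adj_comp T (adjoint T).
have a_pos : positive a := positive_adjoint_mul H_neq0 T.
have b_pos : positive b.
  by have := positive_adjoint_mul K_neq0 (adjoint T); rewrite adjoint_adjoint.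
pose s t := Num.sqrt t `^ alpha.
have s0 t : 0 <= s t := powR_ge0 _ _.
have powop_rep (L : hilbertModType A) (L_neq0 : exists z : L, z <> 0)
    (c : opalg L_neq0 (@inner_cauchy_schwarz R A L)) : positive c ->
    represents c (realfun s)
      (powop (cfc Num.sqrt c) alpha : opalg L_neq0 (@inner_cauchy_schwarz R A L)).
  move=> c_pos; have root_rep := cfc_represents c_pos rootc.
  by apply: (cfc_comp c_pos root_rep) => // t _; exact: sqrtr_ge0.
have a_pow := powop_rep _ _ _ a_pos; have b_pow := powop_rep _ _ _ b_pos.
have a_f := cfc_comp a_pos a_pow (fun t _ => s0 t) fc.
have a_g := cfc_comp a_pos a_pow (fun t _ => s0 t) gc.
have b_g := cfc_comp b_pos b_pow (fun t _ => s0 t) gc.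
have -> : absop (adjoint T) = cfc Num.sqrt b by rewrite /absop adjoint_adjoint.
rewrite -[absop T]/(cfc Num.sqrt a).
pose F : BH := cfc f (powop (cfc Num.sqrt a) alpha).
pose Ga : BH := cfc g (powop (cfc Num.sqrt a) alpha).
pose Gb : BK := cfc g (powop (cfc Num.sqrt b) alpha).
rewrite -/F -/Gb; rewrite -/F in a_f; rewrite -/Ga in a_g; rewrite -/Gb in b_g.
have s_gt0 t : 0 < t -> 0 < s t by move=> t0; rewrite powR_gt0 // sqrtr_gt0.
have s_nd t u : 0 <= t -> t <= u -> s t <= s u.
  by move=> t0 tu; rewrite ge0_ler_powR ?nnegrE ?sqrtr_ge0 ?(ltW alpha_gt0) // ler_wsqrtr.
have sc : continuous_onR `[0, +oo[%classic s.
  by apply: (continuous_onR_comp _ rootc powc) => t _; rewrite posE sqrtr_ge0.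
have gsc : continuous_onR `[0, +oo[%classic (g \o s).
  by apply: (continuous_onR_comp _ sc gc) => t _; rewrite posE.
pose N := opnorm T; have N0 : 0 <= N := opnorm_ge0 T csH csK.
have key e : 0 < e -> rnorm (inner (T x) y) <= Num.sqrt e * (rnorm x * rnorm y) +
    N `^ (1 - alpha) * rnorm ((F : adjointable H H) x) * rnorm ((Gb : adjointable K K) y).
  move=> e0; pose q t := (s (Num.max t e))^-1.
  have smax t : 0 < s (Num.max t e) by rewrite s_gt0 // lt_max e0 orbT.
  have q0 t : 0 <= q t by rewrite invr_ge0.
  pose Q : BH := cfc q a.
  have a_q : represents a (realfun q) Q.
    exact: cfc_represents a_pos (cutoff_inv_continuous_onR e0 s_gt0 s_nd sc).
  have sq1 t : 0 <= t -> s t * q t <= 1.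
    by move=> t0; rewrite ler_pdivrMr // mul1r s_nd // le_max lexx.
  pose S : BH := 1 - Ga * (Q * F).
  have a_S : represents a (realfun (fun t => 1 - s t * q t)) S.
    have := representsD (represents_poly a 1)
      (representsZ (positive_sa a_pos) (-1) (realfunM a_pos a_g (realfunM a_pos a_q a_f))).
    rewrite rmorph1 scaleN1r; apply: represents_ext => l /(aspectrum_itv a_pos)[t -> _].
    rewrite hornerC !realfunE mulN1r -rmorphB /= mulrCA [g _ * _]mulrC fgE //.
    by rewrite [q t * _]mulrC.
  (* The error term: [1 - s q] vanishes above [e], and [t <= e] below. *)
  have S_le : rnorm (T ((S : adjointable H H) x)) <= Num.sqrt e * rnorm x.
    apply: (calculus_bound x (sqrtr_ge0 e) a_S) => t /andP[t0 _].
    rewrite sqr_sqrtr ?(ltW e0) //; have [et|te] := leP e t.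
      rewrite /q (_ : Num.max t e = t); last exact/max_l.
      rewrite mulfV ?subrr ?expr0n ?mulr0 ?(ltW e0) //.
      by rewrite gt_eqF // s_gt0 // (lt_le_trans e0).
    have := sq1 t t0; have := mulr_ge0 (s0 t) (q0 t); move: (s t * q t) te => w te w0 w1.
    by apply: le_trans (ltW te); rewrite ler_piMr //; nra.
  (* The main term: [sqrt t * q t <= (sqrt t)^(1 - alpha)], because [s t * q t <= 1]. *)
  have Q_le : rnorm (T ((Q : adjointable H H) ((F : adjointable H H) x))) <=
      N `^ (1 - alpha) * rnorm ((F : adjointable H H) x).
    apply: (calculus_bound _ (powR_ge0 _ _) a_q) => t /andP[t0 tN].
    have -> : t * q t ^+ 2 = (Num.sqrt t * q t) ^+ 2 by rewrite exprMn sqr_sqrtr.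
    rewrite ler_sqr ?nnegrE ?powR_ge0 ?mulr_ge0 ?sqrtr_ge0 //.
    have [t_eq0|t_neq0] := eqVneq t 0; first by rewrite t_eq0 sqrtr0 mul0r powR_ge0.
    have root0 : 0 < Num.sqrt t by rewrite sqrtr_gt0 lt_neqAle eq_sym t_neq0.
    have {1}-> : Num.sqrt t = Num.sqrt t `^ (1 - alpha) * s t.
      by rewrite -powRD ?subrK ?powRr1 ?sqrtr_ge0 // gt_eqF ?implybT.
    rewrite -mulrA (le_trans (ler_piMr (powR_ge0 _ _) (sq1 t t0))) //.
    rewrite ge0_ler_powR ?nnegrE ?sqrtr_ge0 ?subr_ge0 //.
    by rewrite -[leRHS](ger0_norm N0) -sqrtr_sqr ler_wsqrtr.
  have split_x : T x = T ((S : adjointable H H) x) +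
      (Gb : adjointable K K) (T ((Q : adjointable H H) ((F : adjointable H H) x))).
    rewrite -(calculus_intertwine _ b_pos gsc a_g b_g) -adjointableD; congr (T _).
    by rewrite /= scaleN1r subrK.
  have Gb_sa := realfun_sa b_pos b_g.
  have Gb_adj u : inner ((Gb : adjointable K K) u) y = inner u ((Gb : adjointable K K) y).
    by rewrite adjointP; congr inner; exact: (congr1 (fun G : adjointable K K => G y) Gb_sa).
  rewrite {1}split_x innerDl Gb_adj (le_trans (rnormD _ _)) // lerD //.
    by rewrite (le_trans (csK _ _)) // mulrA ler_wpM2r ?rnorm_ge0.
  by rewrite (le_trans (csK _ _)) // ler_wpM2r ?rnorm_ge0.
(* The error term of [key] is [O(sqrt e)]; take [e = r^2]. *)
rewrite -subr_le0 leNgt; apply/negP => gap.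
suff : rnorm (inner (T x) y) - N `^ (1 - alpha) * rnorm ((F : adjointable H H) x) *
    rnorm ((Gb : adjointable K K) y) = 0 by move=> gap0; rewrite gap0 ltxx in gap.
apply: (@eq0_of_small _ (rnorm x * rnorm y)); first exact: ltW.
move=> r r0; have := key _ (exprn_gt0 2 r0).
by rewrite sqrtr_sqr gtr0_norm // [r * _]mulrC lerBlDr.
Qed.
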